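(* Let $\alpha>0$. A Borel measure $\boldsymbol\nu$ on $\mathcal D$ is a shift-invariant tail measure with tail index $\alpha$ if and only if there exists a $\mathcal D$-valued random process $\boldsymbol Z$ (called a spectral process for $\boldsymbol\nu$) such that $\mathbb P(\boldsymbol Z=\boldsymbol 0)=0$, $\mathbb E[|\boldsymbol Z_0|^\alpha]=1$, $$\boldsymbol\nu=\int_0^\infty \mathbb E[\delta_{u\boldsymbol Z}]\,\alpha u^{-\alpha-1}\,\mathrm du ,$$ and for all $a<b$, all $t\in\mathbb R$ and all bounded measurable $0$-homogeneous maps $H$ on $\mathcal D$, $$0<\mathbb E\Big[\sup_{a\le s\le b}|\boldsymbol Z_s|^\alpha\Big]<\infty,\qquad \mathbb E[|\boldsymbol Z_t|^\alpha H(\boldsymbol Z)]=\mathbb E[|\boldsymbol Z_0|^\alpha H(B^t\boldsymbol Z)].$$ Furthermore, a shift-invariant tail measure $\boldsymbol\nu$ is entirely determined by (the distribution of) its tail process $\boldsymbol Y$, and the distribution $\mathbb P_{\boldsymbol Y}$ of $\boldsymbol Y$ is related to any spectral process $\boldsymbol Z$ for $\boldsymbol\nu$ by $$\mathbb P_{\boldsymbol Y}=\mathbb E\left[|\boldsymbol Z_0|^\alpha\,\delta_{\frac{Y\boldsymbol Z}{|\boldsymbol Z_0|}}\right],$$ where $Y$ is a Pareto random variable with tail index $\alpha$ (i.e. $\mathbb P(Y>y)=y^{-\alpha}$ for $y\ge1$), independent of $\boldsymbol Z$.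
   Context: Fix $d\ge1$ and a norm $|\cdot|$ on $\mathbb R^d$. $\mathcal D=\mathcal D(\mathbb R,\mathbb R^d)$ is the space of càdlàg functions $\mathbb R\to\mathbb R^d$ endowed with Skorohod's $J_1$ topology ($J_1$ convergence on compact intervals), a Polish space, with its Borel $\sigma$-field (which is the product $\sigma$-field). $\boldsymbol 0$ is the null function; $\boldsymbol y_t$ is the value of $\boldsymbol y$ at $t$; $B^tf=f(\cdot-t)$. A set $A\subset\mathcal D$ is separated from $\boldsymbol 0$ if there are $a\le b$ with $\inf_{\boldsymbol y\in A}\sup_{a\le t\le b}|\boldsymbol y_t|>0$; $\mathcal B_0$ is the class of such sets. A Borel measure $\mu$ on $\mathcal D$ is $\mathcal B_0$-boundedly finite if $\mu(\{\boldsymbol 0\})=0$ and $\mu(A)<\infty$ for every Borel $A\in\mathcal B_0$. A tail measure on $\mathcal D$ with tail index $\alpha>0$ is a $\mathcal B_0$-boundedly finite Borel measure $\boldsymbol\nu$ with $\boldsymbol\nu(\{\boldsymbol 0\})=0$, $\boldsymbol\nu(\{\boldsymbol y:|\boldsymbol y_0|>1\})=1$ and $\boldsymbol\nu(tA)=t^{-\alpha}\boldsymbol\nu(A)$ for all $t>0$ and Borel $A$. It is shift-invariant if it is invariant under every $B^t$, $t\in\mathbb R$. Its tail process $\boldsymbol Y$ is a random element of $\mathcal D$ with distribution $\boldsymbol\nu(\cdot\cap\{\boldsymbol y:|\boldsymbol y_0|>1\})$. A map $H$ on $\mathcal D$ is $r$-homogeneous if $H(t\boldsymbol y)=t^rH(\boldsymbol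 y)$ for all $t>0$, $\boldsymbol y\in\mathcal D$. For a nonnegative random variable $W$ and a random element $X$, $\mathbb E[W\delta_X]$ denotes the measure $f\mapsto\mathbb E[Wf(X)]$; on the event $|\boldsymbol Z_0|=0$ the integrand $|\boldsymbol Z_0|^\alpha f(Y\boldsymbol Z/|\boldsymbol Z_0|)$ is understood as $0$. *)

(* Defs.v *)
From HB Require Import structures.
From mathcomp Require Import all_boot all_order all_algebra.
From mathcomp Require Import all_classical all_reals all_analysis.

Set Implicit Arguments.
Unset Strict Implicit.
Unset Printing Implicit Defensive.

Import Order.TTheory GRing.Theory Num.Theory.
Import numFieldNormedType.Exports.

Local Open Scope classical_set_scope.
Local Open Scope ring_scope.

Definition is_norm (R : realType) (d : nat) (N : 'rV[R]_d -> R) : Prop :=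
  [/\ forall x y, N (x + y) <= N x + N y,
      forall a x, N (a *: x) = `|a| * N x &
      forall x, N x = 0 -> x = 0].

Definition is_cadlag (R : realType) (d : nat) (y : R -> 'rV[R]_d) : Prop :=
  forall t, (y @ t^'+ --> y t) /\ cvg (y @ t^'-).

Record cadlag (R : realType) (d : nat) : Type := Cadlag {
  cadlag_fun :> R -> 'rV[R]_d ;
  cadlagP : is_cadlag cadlag_fun }.

Section cadlag_operations.
Context (R : realType) (d : nat).
Implicit Types (y : cadlag R d) (u t : R).

Fact cadlag0_subproof : is_cadlag (fun _ : R => 0 : 'rV[R]_d).
Proof. by move=> t; split; [|apply/cvg_ex; exists 0]; exact: cvg_cst. Qed.

Definition cadlag0 : cadlag R d := Cadlag cadlag0_subproof.

Fact cadlag_scale_subproof u y : is_cadlag (fun s => u *: y s).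
Proof.
move=> t; have [yr /cvg_ex[l yl]] := cadlagP y t.
by split; [|apply/cvg_ex; exists (u *: l)]; exact: cvgZl_tmp.
Qed.

Definition cadlag_scale u y : cadlag R d := Cadlag (cadlag_scale_subproof u y).

Fact cadlag_shift_subproof t y : is_cadlag (fun s => y (s - t)).
Proof.
have shr s : (r - t) @[r --> s^'+] --> (s - t)^'+.
  move=> A [e /= e0 eA]; exists e => //= r /= sr rs.
  by apply: eA; rewrite /= ?opprB ?addrA ?subrK// ?ltrD2r.
have shl s : (r - t) @[r --> s^'-] --> (s - t)^'-.
  move=> A [e /= e0 eA]; exists e => //= r /= sr rs.
  by apply: eA; rewrite /= ?opprB ?addrA ?subrK// ?ltrD2r.
move=> s; have [yr /cvg_ex[l yl]] := cadlagP y (s - t).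
split; first exact: (cvg_comp _ _ (shr s) yr).
by apply/cvg_ex; exists l; exact: (cvg_comp _ _ (shl s) yl).
Qed.

(* B^t *)
Definition cadlag_shift t y : cadlag R d := Cadlag (cadlag_shift_subproof t y).

End cadlag_operations.

Arguments cadlag0 {R d}.

Section J1_topology.
Context (R : realType) (d : nat).
Implicit Types (x y : cadlag R d) (A B : set (cadlag R d)).

(* [x_n --> y] for J1 on compact intervals iff there are increasing bijections
   [l_n] of the line with [l_n --> id] uniformly and [x_n \o l_n --> y]
   uniformly on compacts, i.e. iff for every [e > 0], eventually
   [J1_ball y e x_n]. As J1 is metrizable, its open sets are the sets containing
   some [J1_ball y e] around each of their points [y]. [ball] is the ball of the
   supremum norm of R^d; all norms yield the same topology. *)
Definition J1_ball y (e : R) : set (cadlag R d) :=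
  [set x | exists l : R -> R,
    [/\ {homo l : s t / s < t}, bijective l,
        forall s, `|l s - s| < e &
        forall s, `|s| <= e^-1 -> ball (y s) e (x (l s))]].

Definition J1_open : set_system (cadlag R d) :=
  [set A | forall y, A y -> exists2 e : R, 0 < e & J1_ball y e `<=` A].

Lemma le_J1_ball y (e1 e2 : R) : 0 < e1 -> e1 <= e2 ->
  J1_ball y e1 `<=` J1_ball y e2.
Proof.
move=> e0 e12 x [l [lh lb le lx]]; exists l; split => // s.
  by rewrite (lt_le_trans (le s)).
move=> se; apply: (le_ball e12); apply: lx; apply: (le_trans se).
by rewrite lef_pV2// posrE (lt_le_trans e0).
Qed.

Fact J1_openT : J1_open setT.
Proof. by move=> y _; exists 1. Qed.

Fact J1_openI : setI_closed J1_open.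
Proof.
move=> A B oA oB y [/oA[e e0 eA] /oB[f f0 fB]].
exists (Num.min e f); first by rewrite lt_min e0.
move=> x ex; split.
- by apply: eA; apply: le_J1_ball ex; rewrite ?lt_min ?e0// ge_min lexx.
- by apply: fB; apply: le_J1_ball ex; rewrite ?lt_min ?e0// ge_min lexx orbT.
Qed.

Fact J1_open_bigcup (I : Type) (f : I -> set (cadlag R d)) :
  (forall i, J1_open (f i)) -> J1_open (\bigcup_i f i).
Proof.
move=> fo y [i _ /fo[e e0 ef]]; exists e => //.
by move=> x /ef fx; exists i.
Qed.

HB.instance Definition _ := gen_eqMixin (cadlag R d).
HB.instance Definition _ := gen_choiceMixin (cadlag R d).
HB.instance Definition _ := isPointed.Build (cadlag R d) cadlag0.
HB.instance Definition _ := isOpenTopological.Build (cadlag R d)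
  J1_openT J1_openI J1_open_bigcup.

HB.instance Definition _ := Measurable.copy (cadlag R d)
  (g_sigma_algebraType (@open (cadlag R d))).

End J1_topology.

Section tail_measures.
Context (R : realType) (d : nat) (N : 'rV[R]_d -> R).
Local Notation D := (cadlag R d).
Local Open Scope ereal_scope.

Definition sup_on (a b : R) (f : R -> R) : \bar R :=
  ereal_sup [set (f t)%:E | t in `[a, b]%classic].

Definition separated_from0 (A : set D) : Prop :=
  exists a b : R, (a <= b)%R /\
    0 < ereal_inf [set sup_on a b (fun t => N (y t)) | y in A].

Definition boundedly_finite (nu : {measure set D -> \bar R}) : Prop :=
  nu [set cadlag0] = 0 /\
  forall A, measurable A -> separated_from0 A -> nu A < +oo.

Definition exceedance : set D := [set y | (1 < N (y 0%R))%R].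

Definition tail_measure (alpha : R) (nu : {measure set D -> \bar R}) : Prop :=
  [/\ boundedly_finite nu,
      nu [set cadlag0] = 0,
      nu exceedance = 1 &
      forall t A, (0 < t)%R -> measurable A ->
        nu (cadlag_scale t @` A) = (t `^ (- alpha))%:E * nu A].

Definition shift_invariant (nu : {measure set D -> \bar R}) : Prop :=
  forall t A, measurable A -> pushforward nu (cadlag_shift t) A = nu A.

Definition tail_process (nu : {measure set D -> \bar R})
    (disp : measure_display) (Om : measurableType disp)
    (P : probability Om R) (Y : {RV P >-> D}) : Prop :=
  forall A, measurable A -> distribution P Y A = nu (A `&` exceedance).

Definition homogeneous (r : R) (H : D -> R) : Prop :=
  forall t y, (0 < t)%R -> H (cadlag_scale t y) = (t `^ r * H y)%R.

(* E[W delta_X]; where [W] vanishes the integrand is 0 whatever [X] is, which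
   covers the junk value of [Y Z / |Z_0|] on the event [|Z_0| = 0]. *)
Definition weighted_law (disp : measure_display) (Om : measurableType disp)
    (P : probability Om R) (W : Om -> R) (X : Om -> D) (A : set D) : \bar R :=
  \int[P]_w ((W w)%:E * \d_(X w) A).

Definition spectral_process (alpha : R) (nu : {measure set D -> \bar R})
    (disp : measure_display) (Om : measurableType disp)
    (P : probability Om R) (Z : {RV P >-> D}) : Prop :=
  [/\ P (Z @^-1` [set cadlag0]) = 0,
      'E_P[fun w => (N (Z w 0%R) `^ alpha)%R] = 1,
      forall A, measurable A ->
        nu A = \int[lebesgue_measure]_(u in `]0%R, +oo[%classic)
          (weighted_law P (cst 1%R) (fun w => cadlag_scale u (Z w)) A
           * (alpha * u `^ (- alpha - 1))%:E) &
      forall (a b t : R) (H : D -> R), (a < b)%R ->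
        measurable_fun [set: D] H -> bounded_fun H -> homogeneous 0 H ->
        0 < \int[P]_w sup_on a b (fun s => (N (Z w s) `^ alpha)%R) < +oo /\
        'E_P[fun w => (N (Z w t) `^ alpha * H (Z w))%R] =
        'E_P[fun w => (N (Z w 0%R) `^ alpha * H (cadlag_shift t (Z w)))%R]].

Definition pareto (alpha : R) (disp : measure_display)
    (Om : measurableType disp) (P : probability Om R) (W : {RV P >-> R}) :=
  forall y : R, (1 <= y)%R -> P [set w | (y < W w)%R] = (y `^ (- alpha))%:E.

End tail_measures.

Definition independent_rv (R : realType) (disp disp1 disp2 : measure_display)
    (Om : measurableType disp) (T1 : measurableType disp1)
    (T2 : measurableType disp2) (P : probability Om R)
    (X1 : {RV P >-> T1}) (X2 : {RV P >-> T2}) : Prop :=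
  forall A B, measurable A -> measurable B ->
    P (X1 @^-1` A `&` X2 @^-1` B) = (P (X1 @^-1` A) * P (X2 @^-1` B))%E.

(* Main.v *)
(* Evaluations are J1-measurable, as right limits of suprema over open intervals,
   which are lower semicontinuous. A nonzero path is nonzero at some rational, so a
   measure that does not charge the null path is determined by its restrictions to
   the sets [N (y s) > 0]; homogeneity and shift invariance bring these back to
   [N (y 0) > 1], which is why the tail process determines nu.
   Given a spectral process Z, nu is the image of theta x P under (u, w) |-> u Z(w),
   where theta(du) = alpha u^(-alpha-1) du. Substituting u = v / f(Z) with f
   1-homogeneous gives the polar formula
     nu(g) = int theta(dv) E[f(Z)^alpha g(v Z / f(Z))]  for g vanishing on [f = 0],
   from which homogeneity, local finiteness, shift invariance and the law of the
   tail process are read off, for f(y) = N (y s) or f(y) = sup_[a,b] N (y _).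
   Conversely, choose a measurable 1-homogeneous tau, positive off the null path,
   with nu(tau > 1) = 1. Under P = nu(. /\ [tau > 1]), tau is a Pareto variable
   independent of Z(y) = y / tau(y), whence nu is represented by Z on [tau > 1],
   and everywhere by homogeneity. *)
Require Import Defs.
From HB Require Import structures.
From mathcomp Require Import all_boot all_order all_algebra.
From mathcomp Require Import all_classical all_reals all_analysis.
From mathcomp Require Import measurable_realfun lra.
Import Order.TTheory GRing.Theory Num.Theory.
Import numFieldNormedType.Exports.
Local Open Scope classical_set_scope.
Local Open Scope ring_scope.

Set Implicit Arguments.
Unset Strict Implicit.
Unset Printing Implicit Defensive.

(** * Measurability for the J1 topology *)

Section norm.
Context {R : realType} {d : nat} {N : 'rV[R]_d -> R} (hN : is_norm N).

Lemma norm0 : N 0 = 0.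
Proof. by case: hN => _ NZ _; rewrite -(scale0r 0) NZ normr0 mul0r. Qed.

Lemma normZ a x : N (a *: x) = `|a| * N x.
Proof. by case: hN. Qed.

Lemma normN x : N (- x) = N x.
Proof. by rewrite -scaleN1r normZ normrN1 mul1r. Qed.

Lemma norm_ge0 x : 0 <= N x.
Proof.
case: hN => ND _ _; have := ND x (- x).
by rewrite subrr norm0 normN; lra.
Qed.

(** Expand [x - y] in the standard basis: each coordinate is at most the supremum norm, so the sum
    of the norms of the basis vectors is a Lipschitz constant. The summand 1 makes [C] positive. *)
Lemma norm_lipschitz : exists2 C : R, 0 < C & forall x y, N x - N y <= C * `|x - y|.
Proof.
pose C := 1 + \sum_(j < d) N (delta_mx 0 j).
have C0 : 0 < C by rewrite ltr_pwDl// sumr_ge0// => j _; exact: norm_ge0.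
exists C => // x y.
case: hN => ND _ _.
have NS (s : seq 'I_d) (f : 'I_d -> 'rV[R]_d) :
    N (\sum_(j <- s) f j) <= \sum_(j <- s) N (f j).
  elim/big_rec2 : _ => [|j a b _ ba]; first by rewrite norm0.
  by rewrite (le_trans (ND _ _))// lerD2l.
have -> : N x = N (x - y + y) by rewrite subrK.
rewrite lerBlDr (le_trans (ND _ _))// lerD2r.
rewrite [in leLHS](row_sum_delta (x - y)) (le_trans (NS _ _))//.
rewrite mulrDl mul1r ler_wpDl// mulr_suml ler_sum// => j _.
rewrite normZ mulrC ler_wpM2l ?norm_ge0//.
rewrite [leRHS]/Num.Def.normr/= mx_normrE; apply/bigmax_geP; right => /=.
by exists (ord0, j).
Qed.

End norm.

(** * The J1 Borel sigma-field: shifts, scalings and evaluations *)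

Section cadlag_measurability.
Context {R : realType} {d : nat}.
Local Notation D := (cadlag R d).
Implicit Types (y x : D) (s t u : R).

Lemma J1_open_measurable (A : set D) : J1_open A -> measurable A.
Proof. by move=> oA; apply: sub_sigma_algebra. Qed.

Lemma J1_measurable_fun {disp} {T : measurableType disp} (f : T -> D) :
  (forall A, J1_open A -> measurable (f @^-1` A)) -> measurable_fun setT f.
Proof.
move=> mf; apply: (@measurability _ _ T D setT f (@open D)) => //.
by move=> _ [A oA <-]; rewrite setTI; exact: mf.
Qed.

Lemma J1_ball_center y (e : R) : 0 < e -> J1_ball y e y.
Proof.
move=> e0; exists id; split => // [|s|s _].
- exact: (Bijective (g := id)).
- by rewrite subrr normr0.
- exact: ballxx.
Qed.

(** The union of the balls of radius [e' < e] is open: a time change of size [e'] followed by one of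
    size [f] still has size below [e] once [f] is small. *)
Lemma J1_ball_interior y (e : R) : 0 < e ->
  exists A, [/\ J1_open A, A y & A `<=` J1_ball y e].
Proof.
move=> e0; exists [set x | exists e', 0 < e' < e /\ J1_ball y e' x]; split.
- move=> x [e' [/andP[e'0 e'e] [l [lh lb le lx]]]].
  have B0 : 0 < e'^-1 + e' by rewrite addr_gt0// invr_gt0.
  pose e'' := (e + e') / 2.
  have e'e'' : e' < e'' by rewrite /e''; lra.
  (* The first bound keeps [e' + f] at most [e'' < e]. The second makes the window of radius [f^-1]
     contain that of radius [e'^-1] moved by at most [e']. *)
  pose f := Num.min (e'' - e') (e'^-1 + e')^-1.
  have f0 : 0 < f by rewrite lt_min subr_gt0 e'e'' invr_gt0.
  have fe : f <= e'' - e' by rewrite ge_min lexx.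
  have fB : e'^-1 + e' <= f^-1.
    by rewrite -[leLHS]invrK lef_pV2 ?posrE ?invr_gt0// ge_min lexx orbT.
  exists f => // z [m [mh mb me mz]].
  exists e''; split; first by apply/andP; split; rewrite /e''; lra.
  exists (m \o l); split.
  + by move=> s t /lh /mh.
  + exact: bij_comp.
  + move=> s /=; have -> : m (l s) - s = (m (l s) - l s) + (l s - s) by lra.
    rewrite (le_lt_trans (ler_normD _ _))//.
    by have := me (l s); have := le s; lra.
  + move=> s se.
    have se' : `|s| <= e'^-1.
      by rewrite (le_trans se)// lef_pV2 ?posrE// ?ltW// (lt_trans e'0).
    apply: (@le_ball _ _ _ (e' + f)); first by lra.
    apply: (@ball_triangle _ _ (x (l s))); first exact: lx.
    apply: mz; rewrite (le_trans _ fB)//.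
    have -> : l s = s + (l s - s) by lra.
    rewrite (le_trans (ler_normD _ _))//.
    by have := le s; lra.
- exists (e / 2); split; first by apply/andP; split; lra.
  by apply: J1_ball_center; lra.
- by move=> x [e' [/andP[e'0 e'e]]]; apply: le_J1_ball => //; exact: ltW.
Qed.

(** Shifts are J1 continuous: conjugate the time change by the translation, and take a radius whose
    window contains the one for [e] enlarged by [|t|]. *)
Lemma measurable_shift t : measurable_fun [set: D] (cadlag_shift t).
Proof.
apply: J1_measurable_fun => A oA; apply: J1_open_measurable => y /oA[e e0 eA].
have B0 : 0 < e^-1 + `|t| by rewrite ltr_pwDl// invr_gt0.
pose f := Num.min e (e^-1 + `|t|)^-1.
have f0 : 0 < f by rewrite lt_min e0 invr_gt0.
have fe : f <= e by rewrite ge_min lexx.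
have fB : e^-1 + `|t| <= f^-1.
  by rewrite -[leLHS]invrK lef_pV2 ?posrE ?invr_gt0// ge_min lexx orbT.
exists f => // x [l [lh lb le lx]]; apply: eA.
exists (fun s => l (s - t) + t); split.
- by move=> s s' ss'; rewrite ltrD2r lh// ltrD2r.
- case: lb => g lg gl; exists (fun s => g (s - t) + t) => s.
    by rewrite addrK lg subrK.
  by rewrite addrK gl subrK.
- move=> s; have -> : l (s - t) + t - s = l (s - t) - (s - t) by lra.
  by rewrite (lt_le_trans (le _)).
- move=> s se /=; rewrite addrK; apply: (le_ball fe); apply: lx.
  by rewrite (le_trans (ler_normB _ _))// (le_trans _ fB)// lerD2r.
Qed.

(** Near [t] the path is bounded by [|y t| + |l| + 1], where [l] is its left limit; compactness of
    the segment makes the bound uniform. *)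
Lemma cadlag_bounded y (M : R) : exists2 K, 0 < K &
  forall s, `|s| <= M -> `|y s| <= K.
Proof.
have : near_covering `[- M, M]%classic.
  by apply/compact_near_coveringP; exact: segment_compact.
move=> /(_ R (pinfty_nbhs R) (fun K s => `|y s| <= K) _)[].
  move=> t _; have [yr /cvg_ex[l yl]] := cadlagP y t.
  have /cvgrPdist_lt/(_ 1 ltr01)[e /= e0 er] := yr.
  have /cvgrPdist_lt/(_ 1 ltr01)[f /= f0 fl] := yl.
  exists (ball t (Num.min e f), [set K | `|y t| + `|l| + 1 < K]).
    split; first by apply: nbhsx_ballx; rewrite lt_min e0.
    by exists (`|y t| + `|l| + 1); split => //; exact: num_real.
  move=> [s K] /= []; rewrite /ball/= lt_min => /andP[se sf] HK.
  have yt0 := normr_ge0 (y t); have l0 := normr_ge0 l.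
  have tri (v w : 'rV[R]_d) : `|w| <= `|v| + `|v - w|.
    have -> : `|w| = `|v - (v - w)| by rewrite opprB addrC subrK.
    exact: ler_normB.
  case: (ltgtP t s) => [ts|st|<-]; last by lra.
    by have := er s se ts; have := tri (y t) (y s); lra.
  by have := fl s sf st; have := tri l (y s); lra.
move=> K [_ HK]; exists (Num.max (K + 1) 1); first by rewrite lt_max ltr01 orbT.
move=> s sM; rewrite (le_trans (HK (K + 1) _ s _))// ?ltrDl//.
  by rewrite /= in_itv/= -ler_norml.
by rewrite le_max lexx.
Qed.

(** The same time change serves for the scaled paths. The error splits into a term controlled by the
    distance of [x] to [y] and one controlled by [|v - u|], since [y] is bounded on the window. *)
Lemma scale_J1_continuous u y (e : R) : 0 < e -> exists2 f, 0 < f &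
  forall v x, `|v - u| < f -> J1_ball y f x ->
  J1_ball (cadlag_scale u y) e (cadlag_scale v x).
Proof.
move=> e0; have [K K0 yK] := cadlag_bounded y e^-1.
(* [f <= 1] gives [|v| <= |u| + 1]; the last two bounds make each half of the error at most
   [e / 2]. *)
pose f := Num.min (Num.min e 1) (Num.min (e / (2 * (`|u| + 1))) (e / (2 * K))).
have u1 : 0 < `|u| + 1 by rewrite ltr_pwDr.
have f0 : 0 < f.
  by rewrite !lt_min e0 ltr01/= !divr_gt0// mulr_gt0.
have [fe f1 fu fK] : [/\ f <= e, f <= 1, (`|u| + 1) * f <= e / 2 & K * f <= e / 2].
  split; rewrite ?(ge_min, lexx, orbT)//.
    rewrite mulrC -ler_pdivlMr// -mulrA -invfM.
    by rewrite !ge_min lexx !orbT.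
  rewrite mulrC -ler_pdivlMr// -mulrA -invfM.
  by rewrite !ge_min lexx !orbT.
exists f => // v x vu [l [lh lb le lx]]; exists l; split => // s.
  by rewrite (lt_le_trans (le s)).
move=> se; have sf : `|s| <= f^-1.
  by rewrite (le_trans se)// lef_pV2.
have := lx s sf; rewrite -!ball_normE /= => yx.
have -> : u *: y s - v *: x (l s) = v *: (y s - x (l s)) - (v - u) *: y s.
  by rewrite scalerBr scalerBl opprB addrACA addrC addrA addrNK addrC.
rewrite (le_lt_trans (ler_normB _ _))// !normrZ.
have vu1 : `|v| <= `|u| + 1.
  have -> : v = u + (v - u) by lra.
  by rewrite (le_trans (ler_normD _ _))// lerD2l (le_trans (ltW vu)).
have H1 : `|v| * `|y s - x (l s)| <= (`|u| + 1) * `|y s - x (l s)|.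
  by rewrite ler_wpM2r.
have H2 : (`|u| + 1) * `|y s - x (l s)| < (`|u| + 1) * f by rewrite ltr_pM2l.
have H3 : `|v - u| * `|y s| <= f * K.
  by rewrite ler_pM// ?yK// ltW.
by rewrite (mulrC K) in fK; lra.
Qed.

(* Scaling is jointly continuous and R is second countable, so the preimage of
   an open set is a countable union of open rectangles. *)
Lemma measurable_scale2 :
  measurable_fun [set: R * D] (fun p => cadlag_scale p.1 p.2).
Proof.
apply: J1_measurable_fun => A oA.
(* The largest open set whose points are sent into [A] by every scalar in []p, q[]. *)
pose V (p q : R) := \bigcup_(B in [set B : set D | J1_open B /\
  forall u y, p < u < q -> B y -> A (cadlag_scale u y)]) B.
have oV p q : J1_open (V p q).
  rewrite /V bigcup_mkcond; apply: J1_open_bigcup => B.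
  case: ifPn => [/set_mem[]//|_]; exact: (@open0 D).
rewrite (_ : _ @^-1` _ = \bigcup_(p : rat) \bigcup_(q : rat)
    (`]ratr p, ratr q[%classic `*` V (ratr p) (ratr q))); last first.
  apply/seteqP; split=> [[u y]/= Auy|[u y] [p _] [q _] [/=]]; last first.
    by rewrite in_itv/= => upq [B [_ HB]] By; exact: HB.
  have [e e0 eA] := oA _ Auy.
  have [f f0 fH] := scale_J1_continuous u y e0.
  have [B [oB By Bf]] := J1_ball_interior y f0.
  have /rat_in_itvoo[p /itvP pH] : u - f < u by lra.
  have /rat_in_itvoo[q /itvP qH] : u < u + f by lra.
  exists p => //; exists q => //; split; first by rewrite /= in_itv/= pH qH.
  exists B => //; split => // v x /andP[pv vq] Bx; apply: eA; apply: fH.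
    have pu : u - f < ratr p by rewrite pH.
    have qu : ratr q < u + f by rewrite qH.
    by rewrite ltr_norml; apply/andP; split; lra.
  exact: Bf.
apply: bigcupT_measurable_rat => p; apply: bigcupT_measurable_rat => q.
by apply: measurableX => //; apply: J1_open_measurable.
Qed.

Lemma ex_natSinv_lt (e : R) : 0 < e -> exists n, n.+1%:R^-1 < e.
Proof.
move=> e0; exists (Num.truncn e^-1).
by rewrite -[ltRHS]invrK ltf_pV2 ?posrE ?invr_gt0// truncnS_gt.
Qed.

Section evaluation.
Variable N : 'rV[R]_d -> R.
Hypothesis hN : is_norm N.

(* Unlike evaluations, the supremum over an open interval is lower
   semicontinuous for J1; evaluations are limits of such suprema. *)
Lemma J1_open_exceed (a b c : R) :
  J1_open [set y : D | exists s, a < s < b /\ c < N (y s)].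
Proof.
have [C C0 NC] := norm_lipschitz hN.
move=> y [s [/andP[sa sb] cs]].
(* In order: [l s] stays in []a, b[], the value at [l s] stays above [c], and [s] lies in the
   window. *)
pose e := Num.min (Num.min (s - a) (b - s)) (Num.min ((N (y s) - c) / C) (`|s| + 1)^-1).
have e0 : 0 < e by rewrite !lt_min !subr_gt0 sa sb divr_gt0 ?subr_gt0// invr_gt0 ltr_wpDl.
have [ea eb ec es] : [/\ e <= s - a, e <= b - s, C * e <= N (y s) - c & e <= (`|s| + 1)^-1].
  split; rewrite ?(ge_min, lexx, orbT)//.
  by rewrite mulrC -ler_pdivlMr// !ge_min lexx !orbT.
exists e => // x [l [lh lb le lx]]; exists (l s); split.
  by have := le s; rewrite ltr_norml => /andP[? ?]; apply/andP; split; lra.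
have /lx : `|s| <= e^-1.
  apply: (@le_trans _ _ (`|s| + 1)); first by rewrite lerDl.
  by rewrite -[leLHS]invrK lef_pV2// posrE invr_gt0 ltr_wpDl.
rewrite -ball_normE /= => yx.
have := NC (y s) (x (l s)).
have : C * `|y s - x (l s)| < C * e by rewrite ltr_pM2l.
lra.
Qed.

Lemma cadlag_right_lt y t c : N (y t) < c ->
  exists2 e, 0 < e & forall s, t < s < t + e -> N (y s) < c.
Proof.
have [C C0 NC] := norm_lipschitz hN.
move=> yc; have [yr _] := cadlagP y t.
have c0 : 0 < (c - N (y t)) / C by rewrite divr_gt0// subr_gt0.
have /cvgrPdist_lt/(_ _ c0)[e /= e0 er] := yr.
exists e => // s /andP[ts se].
have H : `|y t - y s| < (c - N (y t)) / C.
  by apply: er => //=; rewrite ltr_distl; apply/andP; split; lra.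
have := NC (y s) (y t); rewrite distrC.
by move: H; rewrite ltr_pdivlMr// mulrC; lra.
Qed.

Lemma cadlag_right_gt y t c : c < N (y t) ->
  exists2 e, 0 < e & forall s, t < s < t + e -> c < N (y s).
Proof.
have [C C0 NC] := norm_lipschitz hN.
move=> yc; have [yr _] := cadlagP y t.
have c0 : 0 < (N (y t) - c) / C by rewrite divr_gt0// subr_gt0.
have /cvgrPdist_lt/(_ _ c0)[e /= e0 er] := yr.
exists e => // s /andP[ts se].
have H : `|y t - y s| < (N (y t) - c) / C.
  by apply: er => //=; rewrite ltr_distl; apply/andP; split; lra.
have := NC (y t) (y s).
by move: H; rewrite ltr_pdivlMr// mulrC; lra.
Qed.

(** By right continuity, [N (y t) < c] iff for some [n] no point of []t, t + 1/(n+1)[] has a value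
    above [c - 1/(n+1)]; the latter is the complement of a J1 open set. *)
Lemma measurable_eval t : measurable_fun [set: D] (fun y => N (y t)).
Proof.
move=> mD; apply: (measurability _ (RGenInftyO.measurableE R)) => //.
move=> _ [_ [c ->] <-]; rewrite setTI.
rewrite (_ : _ @^-1` _ = \bigcup_n
   ~` [set y : D | exists s, t < s < t + n.+1%:R^-1 /\ c - n.+1%:R^-1 < N (y s)]); last first.
  apply/seteqP; split=> y /=; rewrite in_itv/=.
    move=> yc; pose c' := (c + N (y t)) / 2.
    have /cadlag_right_lt[e e0 He] : N (y t) < c' by rewrite /c'; lra.
    have m0 : 0 < Num.min e (c - c') by rewrite lt_min e0 subr_gt0 /c'; lra.
    have [n] := ex_natSinv_lt m0; rewrite lt_min => /andP[ne nc].
    exists n => // -[s [/andP[ts st] H]].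
    have : N (y s) < c' by apply: He; rewrite ts (lt_trans st)// ltrD2l.
    by move: nc H; set r := n.+1%:R^-1 => nc H; lra.
  move=> [n _ H]; have n0 : 0 < n.+1%:R^-1 :> R by rewrite invr_gt0.
  rewrite ltNge; apply/negP => cy; apply: H.
  have /cadlag_right_gt[e e0 He] : c - n.+1%:R^-1 < N (y t).
    by move: n0; set r := n.+1%:R^-1 => n0; lra.
  pose m := Num.min e n.+1%:R^-1.
  have m0 : 0 < m by rewrite lt_min e0.
  have [me mn] : m <= e /\ m <= n.+1%:R^-1 by rewrite !ge_min !lexx orbT.
  exists (t + m / 2); split; last apply: He.
    by move: mn; set r := n.+1%:R^-1 => mn; apply/andP; split; lra.
  by apply/andP; split; lra.
apply: bigcupT_measurable => n; apply: measurableC.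
by apply: J1_open_measurable; exact: J1_open_exceed.
Qed.

(** The interior of the interval contributes an open set; the two endpoints are treated by
    evaluation. *)
Lemma measurable_gt_sup_on a b c : a <= b ->
  measurable [set y : D | (c%:E < sup_on a b (fun t => N (y t)))%E].
Proof.
move=> ab.
rewrite (_ : [set _ | _] = [set y : D | exists s, a < s < b /\ c < N (y s)] `|`
   ((fun y : D => N (y a)) @^-1` `]c, +oo[ `|` (fun y : D => N (y b)) @^-1` `]c, +oo[)).
  apply: measurableU; first by apply: J1_open_measurable; exact: J1_open_exceed.
  by apply: measurableU; rewrite -[X in measurable X]setTI; apply: measurable_eval.
apply/seteqP; split => y /=; rewrite ?in_itv/= ?andbT.
  move=> /ereal_sup_gt[_ [s sab <-]].
  move: sab; rewrite /= in_itv/= lte_fin => /andP[sa sb] cs.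
  move: sa sb; rewrite !le_eqVlt => /predU1P[-> _|sa /predU1P[<-|sb]]; [by right; left|by right; right|].
  by left; exists s; rewrite sa sb.
move=> H; have [s [sab cs]] : exists s, a <= s <= b /\ c < N (y s).
  move: H => [[s [/andP[sa sb] cs]]|[ca|cb]].
  - by exists s; rewrite !ltW.
  - by exists a; rewrite lexx.
  - by exists b; rewrite lexx andbT.
apply: (@lt_le_trans _ _ (N (y s))%:E); first by rewrite lte_fin.
by apply: ereal_sup_ubound; exists s.
Qed.

(** An enumeration of the rationals; an index that codes no rational is sent to 0. *)
Definition ratq (i : nat) : R := ratr (odflt 0 (unpickle i : option rat)).

(** A path that is nonzero at [t] is nonzero on some []t, t + e[], which contains a rational. *)
Lemma cadlag_neq0 y : y <> cadlag0 -> exists i, 0 < N (y (ratq i)).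
Proof.
move=> y0; have [t yt] : exists t, y t != 0.
  apply/not_existsP => H; apply: y0; case: y H => f cf H.
  have f0 : f = (fun=> 0) by apply/funext => t; apply/eqP/negP => /negP /H.
  by rewrite /cadlag0; subst f; congr Cadlag; exact: Prop_irrelevance.
have : 0 < N (y t).
  rewrite lt_neqAle eq_sym norm_ge0// andbT; apply: contraNneq yt => /eqP yt.
  by case: hN => _ _ N0; rewrite (N0 _ (eqP yt)).
move=> /cadlag_right_gt[e e0 He].
have /rat_in_itvoo[q qte] : t < t + e by rewrite ltrDl.
exists (pickle q); rewrite /ratq pickleK/=; apply: He.
by move: qte; rewrite in_itv.
Qed.

Lemma measurable_cadlag0 : measurable [set (@cadlag0 R d)].
Proof.
rewrite (_ : [set _] = \bigcap_i (fun y : D => N (y (ratq i))) @^-1` [set 0]).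
  apply: bigcapT_measurable => i.
  by rewrite -[X in measurable X]setTI; apply: measurable_eval.
apply/seteqP; split => y /=; first by move=> -> i _ /=; rewrite (norm0 hN).
by move=> H; apply: contrapT => /cadlag_neq0[i]; rewrite [N _]H// ltxx.
Qed.

End evaluation.
End cadlag_measurability.
(** * The measure alpha u^(-alpha-1) du *)

Section density_measure.
Local Open Scope ereal_scope.
Context {disp} {T : measurableType disp} {R : realType}
  (mu : {measure set T -> \bar R}) (k : T -> R).

(** The two proofs are arguments so that the measure structure, which rests on them, can be inferred
    from the term. *)
Definition density_measure of measurable_fun [set: T] k & (forall x, (0 <= k x)%R) :=
  fun A : set T => \int[mu]_(x in A) (k x)%:E.

Hypotheses (mk : measurable_fun [set: T] k) (k0 : forall x, (0 <= k x)%R).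
Local Notation m := (density_measure mk k0).

Let m0 : m set0 = 0. Proof. exact: integral_set0. Qed.

Let m_ge0 A : 0 <= m A. Proof. by apply: integral_ge0 => x _; rewrite lee_fin. Qed.

Let m_sigma_additive : semi_sigma_additive m.
Proof.
move=> F mF tF mUF; rewrite /density_measure ge0_integral_bigcup//; last 2 first.
  by apply/measurable_EFinP; exact: measurable_funTS.
  by move=> x _; rewrite lee_fin.
apply: is_cvg_ereal_nneg_natsum_cond => n _ _; by apply: integral_ge0 => x _; rewrite lee_fin.
Qed.

HB.instance Definition _ := isMeasure.Build _ _ _ m m0 m_ge0 m_sigma_additive.

Import HBNNSimple.

(** Indicators of level sets come first, where both integrals are that of [k] over the set; simple
    functions follow by linearity, and nonnegative functions by monotone convergence. *)
Lemma ge0_integral_density (f : T -> \bar R) : measurable_fun setT f ->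
  (forall x, 0 <= f x) -> \int[m]_x f x = \int[mu]_x (f x * (k x)%:E).
Proof.
move=> mf f0; pose h := nnsfun_approx measurableT mf.
have fh x : f x = lim ((EFin \o h n) x @[n --> \oo]).
  by apply/esym/cvg_lim => //; exact: cvg_nnsfun_approx.
have nd_h x : nondecreasing_seq (fun n => (h n x)%:E).
  by move=> a b ab; rewrite lee_fin; exact/lefP/nd_nnsfun_approx.
have fkh x : f x * (k x)%:E = lim (((h n x)%:E * (k x)%:E) @[n --> \oo]).
  apply/esym/cvg_lim => //; apply: cvgeZr => //.
  exact: cvg_nnsfun_approx.
have -> : \int[m]_x f x = lim (\int[m]_x (h n x)%:E @[n --> \oo]).
  under eq_integral do rewrite fh.
  apply: monotone_convergence => // [n|n x _|x _]; last exact: nd_h.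
    exact/measurable_EFinP.
  by rewrite lee_fin.
have -> : \int[mu]_x (f x * (k x)%:E) =
    lim (\int[mu]_x ((h n x)%:E * (k x)%:E) @[n --> \oo]).
  under eq_integral do rewrite fkh.
  apply: monotone_convergence => // [n|n x _|x _ a b ab].
  - by apply: emeasurable_funM; exact/measurable_EFinP.
  - by rewrite mule_ge0 ?lee_fin.
  - by rewrite lee_wpmul2r ?lee_fin//; exact: nd_h.
suff hE n : \int[m]_x (h n x)%:E = \int[mu]_x ((h n x)%:E * (k x)%:E).
  by under eq_fun do rewrite hE.
have kh x : (h n x)%:E * (k x)%:E =
    \sum_(y \in range (h n)) (y * \1_(h n @^-1` [set y]) x)%:E * (k x)%:E.
  rewrite fimfunE -fsumEFin// ge0_mule_fsuml// => y.
  exact: nnfun_muleindic_ge0.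
under [RHS]eq_integral do rewrite kh.
rewrite ge0_integral_fsum//; last 2 first.
  move=> y; apply: emeasurable_funM; apply/measurable_EFinP => //.
  exact: measurable_funM.
  move=> y x _; apply: mule_ge0; last by rewrite lee_fin.
  exact: nnfun_muleindic_ge0.
under eq_integral do rewrite fimfunE -fsumEFin//.
rewrite ge0_integral_fsum//; last 2 first.
  by move=> y; apply/measurable_EFinP; exact: measurable_funM.
  by move=> y x _; exact: nnfun_muleindic_ge0.
apply: eq_fsbigr => r; rewrite inE => -[t _ <-].
under eq_integral do rewrite EFinM.
rewrite integralZl_indic_nnsfun// integral_indic// setIT.
under eq_integral do rewrite EFinM -muleA.
rewrite ge0_integralZl ?lee_fin//; last 2 first.
  by apply: emeasurable_funM; exact/measurable_EFinP.
  by move=> x _; rewrite mule_ge0 ?lee_fin.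
congr (_ * _); transitivity (\int[mu]_(x in h n @^-1` [set h n t]) (k x)%:E) => //.
rewrite [LHS]integral_mkcond; apply: eq_integral => x _.
by rewrite patchE indicE; case: ifPn; rewrite ?mul1e ?mul0e.
Qed.

End density_measure.

(** * Lebesgue measure under dilations *)

Section lebesgue_scaling.
Local Open Scope ereal_scope.
Context {R : realType}.
Local Notation mu := (@lebesgue_measure R).

(** [c] times the image of Lebesgue measure under the dilation by [c] agrees with Lebesgue measure
    on intervals, hence on all Borel sets. *)
Lemma ge0_integral_lebesgue_scale (c : R) (f : R -> \bar R) : (0 < c)%R ->
  measurable_fun setT f -> (forall x, 0 <= f x) ->
  \int[mu]_x f (c * x)%R = c^-1%:E * \int[mu]_x f x.
Proof.
move=> c0 mf f0.
pose nc : {nonneg R} := NngNum (ltW c0).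
pose h := (fun x => c * x)%R : _ -> measurableTypeR R.
have mh : measurable_fun setT h by exact: measurable_funM.
have E A : measurable A -> mscale nc (pushforward mu h) A = mu A.
  move=> mA; apply/esym/lebesgue_measure_unique => //= _ [[a b]] _ <-.
  rewrite /mscale/= /pushforward.
  have -> : h @^-1` `]a, b]%classic = `](a / c)%R, (b / c)%R]%classic.
    apply/seteqP; split => x; rewrite /= !in_itv/= ltr_pdivrMr// ler_pdivlMr//;
      by rewrite (mulrC x).
  rewrite !lebesgue_measure_itv/= !lte_fin ltr_pM2r ?invr_gt0//.
  case: ifPn => _; last by rewrite mule0.
  by rewrite -!EFinD -EFinM mulrBr !(mulrC c) !divfK ?gt_eqF.
pose ic : {nonneg R} := NngNum (ltW (eqbRL (invr_gt0 c) c0)).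
have E' A : measurable A -> pushforward mu h A = mscale ic mu A.
  move=> mA; transitivity (ic%:num%:E * mu A) => //.
  by rewrite -E// /mscale/= muleA -EFinM mulVf ?gt_eqF// mul1e.
rewrite -(ge0_integral_mscale _ measurableT ic)//.
transitivity (\int[pushforward mu h]_x f x).
  by rewrite ge0_integral_pushforward.
by apply: eq_measure_integral => A mA _; exact: E'.
Qed.

End lebesgue_scaling.

(** * The measure theta: scaling, rays, sigma-finiteness *)

Section pareto_measure.
Local Open Scope ereal_scope.
Context {R : realType} {alpha : R}.
Hypothesis halpha : (0 < alpha)%R.
Local Notation mu := (@lebesgue_measure R).

(** The extension by 0 makes theta a measure on the whole line that ignores scalars [u <= 0]. *)
Definition pareto_density (u : measurableTypeR R) : R :=
  if (0 < u)%R then (alpha * u `^ (- alpha - 1))%R else 0%R.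

Lemma pareto_density_ge0 u : (0 <= pareto_density u)%R.
Proof. by rewrite /pareto_density; case: ifPn => // _; rewrite mulr_ge0 ?powR_ge0// ltW. Qed.

Lemma measurable_pareto_density : measurable_fun setT pareto_density.
Proof.
apply: measurable_fun_ifT => //.
- exact: measurable_fun_ltr.
- by apply: measurable_funM => //; exact: measurable_powR.
Qed.

Definition pareto_measure :=
  density_measure mu measurable_pareto_density pareto_density_ge0.

HB.instance Definition _ := Measure.on pareto_measure.

Local Notation theta := pareto_measure.

Lemma integral_pareto_measure (f : measurableTypeR R -> \bar R) :
  measurable_fun setT f -> (forall x, 0 <= f x) ->
  \int[theta]_u f u =
  \int[mu]_(u in `]0%R, +oo[) (f u * (alpha * u `^ (- alpha - 1))%:E).
Proof.
move=> mf f0; rewrite ge0_integral_density// [RHS]integral_mkcond.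
apply: eq_integral => u _; rewrite patchE mem_setE in_itv/= andbT /pareto_density.
by case: ifPn => _ //; rewrite mule0.
Qed.

(** The primitive [- u^(-alpha)] rises from -1 at 1 to 0 at infinity. *)
Lemma pareto_measure_gt1 : theta `]1%R, +oo[ = 1.
Proof.
rewrite /pareto_measure /density_measure.
transitivity (\int[mu]_(u in `[1%R, +oo[) (alpha * u `^ (- alpha - 1))%:E).
  rewrite -integral_itv_obnd_cbnd//.
    apply: eq_integral => u; rewrite inE/= in_itv/= andbT => u1.
    by rewrite /pareto_density (lt_trans ltr01 u1).
  apply/measurable_EFinP/measurable_funTS.
  by apply: measurable_funM => //; exact: measurable_powR.
have dF (u : R) : (0 < u)%R -> is_derive u 1%R (fun u : R => - u `^ (- alpha))%R
    (alpha * u `^ (- alpha - 1))%R.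
  move=> u0; apply: DeriveDef.
    by apply: derivableN; apply: derivable_powR; rewrite in_itv/= u0.
  rewrite deriveN; last by apply: derivable_powR; rewrite in_itv/= u0.
  by rewrite -derive1E powR_derive1 ?in_itv/= ?u0// mulNr opprK.
have cF (u : R) : (0 < u)%R -> {for u, continuous (fun u : R => - u `^ (- alpha))%R}.
  by move=> /dF[/derivable1_diffP/differentiable_continuous].
rewrite (@ge0_continuous_FTC2y _ _ (fun u => - u `^ (- alpha))%R 1%R 0%R).
- by rewrite powR1 sub0e EFinN oppeK.
- by move=> x x1; rewrite mulr_ge0 ?powR_ge0// ltW.
- apply: continuous_in_subspaceT => x; rewrite inE/= in_itv/= andbT => x1.
  have x0 := lt_le_trans ltr01 x1.
  have dp : {for x, continuous (fun u : R => u `^ (- alpha - 1))%R}.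
    apply/differentiable_continuous/derivable1_diffP.
    by apply: derivable_powR; rewrite in_itv/= x0.
  by apply: cvgZl_tmp; exact: dp.
(* Beyond this threshold [u^alpha] exceeds [e^-1]. *)
- apply/cvgrPdist_lt => e e0; exists (e^-1 `^ alpha^-1)%R.
  split; first exact: num_real.
  move=> u ue; have ie0 : (0 <= e^-1 :> R)%R by rewrite invr_ge0 ltW.
  have u0 : (0 < u)%R by rewrite (le_lt_trans _ ue)// powR_ge0.
  rewrite sub0r opprK ger0_norm ?powR_ge0// powRN -[ltRHS]invrK.
  rewrite ltf_pV2 ?posrE ?invr_gt0 ?powR_gt0//.
  have := gt0_ltr_powR halpha.
  move=> /(_ (e^-1 `^ alpha^-1)%R u); rewrite !nnegrE powR_ge0 ltW//.
  by rewrite -powRrM mulVf ?gt_eqF// powRr1//; exact.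
- by move=> x x1; have [] := dF x (lt_trans ltr01 x1).
- apply: cvg_at_right_filter; exact: (cF 1%R ltr01).
- move=> x; rewrite in_itv/= andbT => x1.
  by rewrite derive1E; have [_ ->] := dF x (lt_trans ltr01 x1).
Qed.

Lemma pareto_density_scale (c u : R) : (0 < c)%R ->
  pareto_density u = (c `^ (alpha + 1) * pareto_density (c * u))%R.
Proof.
move=> c0; rewrite /pareto_density pmulr_rgt0//; case: ifPn => u0; last by rewrite mulr0.
rewrite powRM ?ltW//.
have -> : (- alpha - 1 = - (alpha + 1))%R by lra.
rewrite (powRN c) [RHS]mulrCA [X in _ = (_ * X)%R]mulrA divff ?mul1r//.
by rewrite gt_eqF// powR_gt0.
Qed.

(** The density is homogeneous of degree [- alpha - 1], which gives [c^(alpha+1)]; the dilation of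
    Lebesgue measure takes back one factor [c]. *)
Lemma pareto_measure_scale (c : R) (f : measurableTypeR R -> \bar R) : (0 < c)%R ->
  measurable_fun setT f -> (forall x, 0 <= f x) ->
  \int[theta]_u f (c * u)%R = (c `^ alpha)%:E * \int[theta]_u f u.
Proof.
move=> c0 mf f0.
have mc : measurable_fun [set: measurableTypeR R] (fun u : measurableTypeR R => c * u : measurableTypeR R)%R.
  exact: measurable_funM.
have mfk : measurable_fun [set: measurableTypeR R] (fun u => f u * (pareto_density u)%:E).
  by apply: emeasurable_funM => //; apply/measurable_EFinP; exact: measurable_pareto_density.
have fk0 u : 0 <= f u * (pareto_density u)%:E.
  by rewrite mule_ge0// lee_fin pareto_density_ge0.
rewrite !ge0_integral_density//; last by exact: (measurableT_comp mf mc).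
pose g (u : measurableTypeR R) := f (c * u)%R * (pareto_density (c * u))%:E.
have mg : measurable_fun setT g by exact: (measurableT_comp mfk mc).
transitivity (\int[mu]_u ((c `^ (alpha + 1))%:E * g u)).
  apply: eq_integral => u _.
  by rewrite /g (pareto_density_scale u c0) EFinM muleCA.
have g0 (u : measurableTypeR R) : setT u -> 0 <= g u by move=> _; exact: fk0.
have k0 : 0 <= (c `^ (alpha + 1))%:E by rewrite lee_fin powR_ge0.
rewrite (ge0_integralZl _ measurableT mg g0 k0).
rewrite (ge0_integral_lebesgue_scale c0 mfk fk0).
rewrite muleA -EFinM powRD; last by rewrite (gt_eqF c0) implybT.
by rewrite powRr1 ?ltW// -mulrA divff ?gt_eqF// mulr1.
Qed.

(** The dilation by [r^-1] reduces the ray to []1, +oo[]. *)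
Lemma pareto_measure_gt (r : R) : (0 < r)%R -> theta `]r, +oo[ = (r `^ (- alpha))%:E.
Proof.
move=> r0.
have r10 : (0 < r^-1)%R by rewrite invr_gt0.
have m1 : measurable_fun [set: measurableTypeR R]
    (fun u : measurableTypeR R => (\1_`]1%R, +oo[%classic u : R)%:E).
  by apply/measurable_EFinP; exact: measurable_indic.
have p1 (u : measurableTypeR R) : 0 <= (\1_`]1%R, +oo[%classic u : R)%:E.
  by rewrite lee_fin.
have mI (x : R) : theta `]x, +oo[ = \int[theta]_u (\1_`]x, +oo[%classic u)%:E.
  by rewrite integral_indic ?setIT.
have := pareto_measure_scale r10 m1 p1.
rewrite -(mI 1%R) pareto_measure_gt1 mule1 -powR_inv1 ?(ltW r0)//.
rewrite -powRrM mulN1r => <-.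
rewrite mI; apply: eq_integral => u _.
rewrite !indicE !mem_setE !in_itv/= !andbT.
by rewrite powR_inv1 ?(ltW r0)// mulrC ltr_pdivlMr// mul1r.
Qed.

Lemma pareto_measure_sigma_finite : sigma_finite setT theta.
Proof.
(* The mass of theta is infinite only near [0+]; the null half-line []-oo, 0]] is joined to the rays
   to cover the line. *)
exists (fun n => `]-oo, 0%R]%classic `|` `]n.+1%:R^-1%R, +oo[%classic).
  apply/esym; rewrite -subTset => u _.
  have [u0|u0] := leP u 0%R; first by exists 0%N => //; left; rewrite /= in_itv.
  have [n nu] := ex_natSinv_lt u0.
  by exists n => //; right; rewrite /= in_itv/= nu.
move=> n; have n0 : (0 < n.+1%:R^-1 :> R)%R by rewrite invr_gt0.
split; first exact: measurableU.
apply: (@le_lt_trans _ _ (theta `]-oo, 0%R] + theta `]n.+1%:R^-1%R, +oo[)).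
  exact: measureU2.
rewrite pareto_measure_gt//.
rewrite [X in X + _](_ : _ = 0) ?add0e ?ltry//.
rewrite /= /pareto_measure /density_measure/=.
apply: integral0_eq => u; rewrite /= in_itv/= => u0.
by rewrite /pareto_density ltNge u0.
Qed.

HB.instance Definition _ := Measure_isSigmaFinite.Build _ _ _ pareto_measure
  pareto_measure_sigma_finite.

End pareto_measure.

(** * Equality of measures on a countable cover *)

Section measure_uniqueness.
Local Open Scope ereal_scope.
Context {disp} {T : measurableType disp} {R : realType}.
Variables m1 m2 : {measure set T -> \bar R}.

(** Cut [A] along the disjoint sets [seqDU F i] and add up the pieces. *)
Lemma eq_measure_bigcup (F : nat -> set T) : (forall i, measurable (F i)) ->
  (forall i A, measurable A -> A `<=` F i -> m1 A = m2 A) ->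
  forall A, measurable A -> A `<=` \bigcup_i F i -> m1 A = m2 A.
Proof.
move=> mF m12 A mA AF.
have mG i : measurable (A `&` seqDU F i).
  apply: measurableI => //; apply: measurableD => //.
  exact: bigsetU_measurable.
have -> : A = \bigcup_i (A `&` seqDU F i).
  by rewrite -setI_bigcupr -seqDU_bigcup_eq; apply/esym/setIidl.
have tG : trivIset setT (fun i => A `&` seqDU F i).
  exact/trivIset_setIl/trivIset_seqDU.
rewrite !measure_bigcup//; apply: eq_eseriesr => i _; apply: (m12 i) => //.
by apply: subset_trans (@subset_seqDU _ _ _); exact: subIsetr.
Qed.

End measure_uniqueness.

(** * Homogeneous measures on the path space *)

Section homogeneous_measures.
Local Open Scope ereal_scope.
Context {R : realType} {d : nat}.
Local Notation D := (cadlag R d).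

Definition homogeneous_measure (alpha : R) (m : {measure set D -> \bar R}) :=
  forall t A, (0 < t)%R -> measurable A ->
    m (cadlag_scale t @` A) = (t `^ (- alpha))%:E * m A.

Lemma cadlag_eq (x y : D) : (forall s, x s = y s) -> x = y.
Proof.
case: x => f cf; case: y => g cg /= /funext fg.
by subst g; congr Cadlag; exact: Prop_irrelevance.
Qed.

Lemma cadlag_scaleA (s t : R) (y : D) :
  cadlag_scale s (cadlag_scale t y) = cadlag_scale (s * t) y.
Proof. by apply: cadlag_eq => u /=; rewrite scalerA. Qed.

Lemma cadlag_scale1 (y : D) : cadlag_scale 1 y = y.
Proof. by apply: cadlag_eq => u /=; rewrite scale1r. Qed.

Lemma cadlag_shift_scale (s t : R) (y : D) :
  cadlag_shift s (cadlag_scale t y) = cadlag_scale t (cadlag_shift s y).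
Proof. exact: cadlag_eq. Qed.

Lemma cadlag_shiftD (s t : R) (y : D) :
  cadlag_shift s (cadlag_shift t y) = cadlag_shift (s + t) y.
Proof. by apply: cadlag_eq => u /=; rewrite opprD addrA. Qed.

Lemma cadlag_shift0 (y : D) : cadlag_shift 0 y = y.
Proof. by apply: cadlag_eq => u /=; rewrite subr0. Qed.

(** Homogeneity is stated with images; as preimages under a measurable map they are visibly
    measurable. *)
Lemma image_scaleE (t : R) (A : set D) : (0 < t)%R ->
  cadlag_scale t @` A = cadlag_scale t^-1 @^-1` A.
Proof.
move=> t0; apply/seteqP; split => [_ [y Ay <-]|y /= Ay].
  by rewrite /= cadlag_scaleA mulVf ?gt_eqF// cadlag_scale1.
exists (cadlag_scale t^-1 y) => //.
by rewrite cadlag_scaleA divff ?gt_eqF// cadlag_scale1.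
Qed.

Lemma measurable_scale (t : R) : measurable_fun [set: D] (cadlag_scale t).
Proof.
have H : measurable_fun [set: D] (fun y => (t, y) : R * D).
  exact: measurable_fun_pair.
exact: (measurableT_comp measurable_scale2 H).
Qed.

Lemma measurable_image_scale (t : R) (A : set D) : (0 < t)%R -> measurable A ->
  measurable (cadlag_scale t @` A).
Proof.
by move=> t0 mA; rewrite image_scaleE// -[X in measurable X]setTI; exact: measurable_scale.
Qed.

(** The dilation by [n + 1] carries subsets of [[f > 1/(n+1)]] into [[f > 1]], and the sets
    [[f > 1/(n+1)]] exhaust [[f > 0]]. *)
Lemma eq_homogeneous_measure (alpha : R) (m1 m2 : {measure set D -> \bar R})
    (f : D -> R) :
  homogeneous_measure alpha m1 -> homogeneous_measure alpha m2 ->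
  measurable_fun setT f ->
  (forall t y, (0 < t)%R -> f (cadlag_scale t y) = (t * f y)%R) ->
  (forall A, measurable A -> A `<=` [set y | (1 < f y)%R] -> m1 A = m2 A) ->
  forall A, measurable A -> A `<=` [set y | (0 < f y)%R] -> m1 A = m2 A.
Proof.
move=> h1 h2 mf fZ m12 A mA A0.
apply: (@eq_measure_bigcup _ _ _ m1 m2 (fun n => [set y | (n.+1%:R^-1 < f y)%R])) => //.
- move=> n; rewrite -[X in measurable X]setTI.
  have -> : [set y | (n.+1%:R^-1 < f y)%R] = f @^-1` `]n.+1%:R^-1%R, +oo[%classic.
    by apply/seteqP; split => y; rewrite /= in_itv/= andbT.
  exact: mf.
- move=> n B mB Bf; have n0 : (0 < n.+1%:R :> R)%R by [].
  have nV : (0 < n.+1%:R^-1 :> R)%R by rewrite invr_gt0.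
  have BE : B = cadlag_scale n.+1%:R^-1 @` (cadlag_scale n.+1%:R @` B).
    rewrite image_comp; apply/seteqP; split => [y By|_ [y By <-]] /=.
      by exists y => //; rewrite /= cadlag_scaleA mulVf ?gt_eqF// cadlag_scale1.
    by rewrite cadlag_scaleA mulVf ?gt_eqF// cadlag_scale1.
  have mB' := measurable_image_scale n0 mB.
  rewrite BE h1// h2//; congr (_ * _); apply: m12 => // _ [y By <-] /=.
  by rewrite fZ// -ltr_pdivrMl// mulr1; exact: Bf.
- by move=> y /A0 /= /ex_natSinv_lt[n ny]; exists n.
Qed.

End homogeneous_measures.

(** * Joint law of a Pareto variable and an independent random element *)

Section pareto_joint_law.
Local Open Scope ereal_scope.
Context {R : realType} {alpha : R} (halpha : (0 < alpha)%R).
Context {disp disp'} {Om : measurableType disp} {T : measurableType disp'}.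
Variable P : probability Om R.
Local Notation theta := (pareto_measure halpha).

(** The rays are stable under intersection and generate the Borel sets, and the rays from [-n], of
    finite mass, exhaust the line. *)
Lemma eq_measure_rays (m1 m2 : {measure set (measurableTypeR R) -> \bar R}) :
  (forall r : R, m1 `]r, +oo[%classic = m2 `]r, +oo[%classic) ->
  (forall r : R, m1 `]r, +oo[%classic < +oo) ->
  forall A, measurable A -> m1 A = m2 A.
Proof.
move=> m12 moo A mA.
apply: (@measure_unique _ R (measurableTypeR R) (@RGenOInfty.G R)
  (fun n => `](- n%:R)%R, +oo[%classic) _ _ _ _ m1 m2) => //.
- exact: RGenOInfty.measurableE.
- move=> _ _ [x ->] [y ->]; exists (Num.max x y); apply/seteqP; split => z;
    rewrite /= !in_itv/= !andbT gt_max; first by case=> -> ->.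
  by move/andP.
- by move=> n; eexists; reflexivity.
- rewrite -subTset => x _; exists (Num.truncn `|x|).+1 => //=.
  rewrite in_itv/= andbT ltrNl (le_lt_trans (ler_norm _))// normrN.
  exact: truncnS_gt.
- by move=> _ [x ->].
Qed.

Variables (W : Om -> measurableTypeR R) (Z : Om -> T).
Hypotheses (mW : measurable_fun setT W) (mZ : measurable_fun setT Z).
Hypothesis WZ : forall r S, (1 <= r)%R -> measurable S ->
  P [set w | (r < W w)%R /\ S (Z w)] = (r `^ (- alpha))%:E * P (Z @^-1` S).

Let Wm : {RV P >-> measurableTypeR R} := mfun_Sub (mem_set mW).
Let Zm : {RV P >-> T} := mfun_Sub (mem_set mZ).

Let mT S : measurable S -> measurable (Z @^-1` S).
Proof. by move=> mS; rewrite -[X in measurable X]setTI; exact: mZ. Qed.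

Let raysE (r : R) S : W @^-1` `]r, +oo[%classic `&` Z @^-1` S =
  [set w | (r < W w)%R /\ S (Z w)].
Proof. by apply/seteqP; split => w; rewrite /= in_itv/= andbT. Qed.

Let mrays (r : R) : measurable (W @^-1` `]r, +oo[%classic).
Proof. by rewrite -[X in measurable X]setTI; exact: mW. Qed.

(** For [r < 1], the case [r = 1] of [WZ] shows that [W] exceeds 1, hence [r], almost surely. *)
Let WZ1 (r : R) S : measurable S ->
  P (W @^-1` `]r, +oo[%classic `&` Z @^-1` S) =
  (Num.max r 1 `^ (- alpha))%:E * P (Z @^-1` S).
Proof.
move=> mS; have [r1|r1] := leP 1%R r; first by rewrite raysE WZ.
rewrite powR1 mul1e; apply/eqP; rewrite eq_le; apply/andP; split.
  apply: le_measure; rewrite ?inE; [|exact: mT|by move=> w []].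
  by apply: measurableI; [exact: mrays|exact: mT].
have := WZ (lexx 1%R) mS; rewrite powR1 mul1e => <-.
rewrite raysE; apply: le_measure; rewrite ?inE -?raysE.
- by apply: measurableI; [exact: mrays|exact: mT].
- by apply: measurableI; [exact: mrays|exact: mT].
- by rewrite !raysE => w [/(lt_trans r1)].
Qed.

Let W1 (r : R) : P (W @^-1` `]r, +oo[%classic) = (Num.max r 1 `^ (- alpha))%:E.
Proof.
by have := WZ1 r measurableT; rewrite preimage_setT setIT probability_setT mule1.
Qed.

(** [WZ] says at once that [W] is Pareto and independent of [Z]. The pair thus has a product law,
    Tonelli integrates over [Z] first, and the law of [W] is theta restricted to []1, +oo[]. *)
Lemma pareto_joint_law (f : measurableTypeR R * T -> \bar R) :
  measurable_fun setT f -> (forall x, 0 <= f x) ->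
  \int[P]_w f (W w, Z w) =
  \int[theta]_u ((\int[P]_w f (u, Z w)) * (\1_`]1%R, +oo[%classic u)%:E).
Proof.
move=> mf f0.
have mWZ : measurable_fun setT (fun w => (W w, Z w)).
  exact: measurable_fun_pair.
have E X : measurable X ->
    (distribution P Wm \x distribution P Zm) X = pushforward P (fun w => (W w, Z w)) X.
  apply: product_measure_unique => A S mA mS.
  (* With [S] fixed, both sides are finite measures in [A], compared on rays. *)
  pose c : {nonneg R} := NngNum (fine_ge0 (measure_ge0 P (Z @^-1` S))).
  have cE : c%:num%:E = P (Z @^-1` S) by rewrite /= fineK// fin_num_measure//; exact: mT.
  transitivity (pushforward (mrestr P (mT mS)) W A) => //.
  transitivity (mscale c (distribution P Wm) A); last by rewrite /mscale muleC cE.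
  apply: eq_measure_rays => // r.
    transitivity (c%:num%:E * P (W @^-1` `]r, +oo[%classic)) => //.
    by rewrite W1 cE muleC -WZ1.
  apply: (@le_lt_trans _ _ (P setT)); last by rewrite probability_setT ltry.
  by apply: le_measure; rewrite ?inE//; apply: measurableI; [exact: mrays|exact: mT].
rewrite -[LHS](@ge0_integral_pushforward _ _ _ _ _ _ mWZ P setT f)//.
transitivity (\int[distribution P Wm \x distribution P Zm]_x f x).
  by apply: eq_measure_integral => A mA _; exact/esym/E.
rewrite fubini_tonelli1// /fubini_F.
have mI : measurable_fun [set: measurableTypeR R] (\1_`]1%R, +oo[%classic : _ -> R).
  exact: measurable_indic.
have I0 (u : measurableTypeR R) : (0 <= \1_`]1%R, +oo[%classic u :> R)%R by [].
pose g (u : measurableTypeR R) := \int[P]_w f (u, Z w).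
have gE u : \int[distribution P Zm]_y f (u, y) = g u.
  rewrite ge0_integral_distribution//.
  exact: measurableT_comp.
have mg : measurable_fun setT g.
  have := measurable_fun_fubini_tonelli_F (m2 := distribution P Zm) f mf f0.
  by congr measurable_fun; apply/funext => u; exact: gE.
have g0 u : 0 <= g u by exact: integral_ge0.
(* The indicator of []1, +oo[] is read as a density; it remains to compare two measures on rays. *)
rewrite -(ge0_integral_density theta mI I0 mg g0).
under eq_integral do rewrite gE.
apply: eq_measure_integral => A mA _.
apply: eq_measure_rays => // r.
  rewrite [LHS]W1.
  transitivity (\int[theta]_(u in `]r, +oo[) (\1_`]1%R, +oo[%classic u)%:E) => //.
  rewrite integral_indic// -(@pareto_measure_gt _ _ halpha) ?lt_max ?ltr01 ?orbT//.
  congr (theta _); apply/seteqP; split => u; rewrite /= !in_itv/= !andbT gt_max.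
    by move=> /andP[? ?]; split.
  by move=> [-> ->].
by rewrite [ltLHS]W1 ltry.
Qed.

End pareto_joint_law.
(** * Spectral representations *)

(** Inversion is the power -1 on nonnegative reals, including at 0, where both are 0. *)
Lemma measurable_funV_ge0 {disp} {T : measurableType disp} {R : realType} (f : T -> R) :
  measurable_fun setT f -> (forall x, 0 <= f x) ->
  measurable_fun setT (fun x => (f x)^-1).
Proof.
move=> mf f0; rewrite (_ : (fun x => _) = fun x => f x `^ (- 1)).
  have mp : measurable_fun [set: R] (fun x => x `^ (- 1)) by exact: measurable_powR.
  exact: (measurableT_comp mp mf).
by apply/funext => x; rewrite powR_inv1.
Qed.

Section spectral_representation.
Local Open Scope ereal_scope.
Context {R : realType} {d : nat} {alpha : R} (halpha : (0 < alpha)%R).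
Local Notation D := (cadlag R d).
Local Notation theta := (pareto_measure halpha).

Lemma ge0_integral_pareto_eq0 (f : measurableTypeR R -> \bar R) :
  measurable_fun setT f -> (forall x, 0 <= f x) ->
  (forall u, (0 < u)%R -> f u = 0) -> \int[theta]_u f u = 0.
Proof.
move=> mf f0 fE; rewrite integral_pareto_measure//.
by apply: integral0_eq => u; rewrite /= in_itv/= andbT => /fE ->; rewrite mul0e.
Qed.

(** As theta does not charge [u <= 0], identities that rest on [u > 0] suffice under the
    integral. *)
Lemma ge0_eq_integral_pareto (f g : measurableTypeR R -> \bar R) :
  measurable_fun setT f -> measurable_fun setT g ->
  (forall x, 0 <= f x) -> (forall x, 0 <= g x) ->
  (forall u, (0 < u)%R -> f u = g u) -> \int[theta]_u f u = \int[theta]_u g u.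
Proof.
move=> mf mg f0 g0 fg.
rewrite (integral_pareto_measure halpha mf f0) (integral_pareto_measure halpha mg g0).
by apply: eq_integral => u; rewrite inE/= in_itv/= andbT => /fg ->.
Qed.

Context {disp} {Om : measurableType disp} (P : probability Om R) (Z : Om -> D).
Hypothesis mZ : measurable_fun setT Z.

Lemma measurable_scale_comp {disp'} {T : measurableType disp'} (c : T -> R) (X : T -> D) :
  measurable_fun setT c -> measurable_fun setT X ->
  measurable_fun setT (fun x => cadlag_scale (c x) (X x)).
Proof.
move=> mc mX; have H : measurable_fun setT (fun x => (c x, X x)).
  exact: measurable_fun_pair.
exact: (measurableT_comp measurable_scale2 H).
Qed.

Let mF : measurable_fun [set: measurableTypeR R * Om]
  (fun p => cadlag_scale p.1 (Z p.2)).
Proof.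
apply: measurable_scale_comp; first exact: measurable_fst.
by apply: (measurableT_comp mZ); exact: measurable_snd.
Qed.

Lemma measurable_polar (f : D -> R) (g : D -> \bar R) :
  measurable_fun setT f -> (forall y, 0 <= f y)%R -> measurable_fun setT g ->
  measurable_fun [set: measurableTypeR R * Om] (fun p =>
    (f (Z p.2) `^ alpha)%:E * g (cadlag_scale (p.1 / f (Z p.2)) (Z p.2))).
Proof.
move=> mf f0 mg; have mfZ := measurableT_comp mf mZ.
have mpow (a : R) : measurable_fun [set: measurableTypeR R * Om]
    (fun p => f (Z p.2) `^ a)%R.
  have mp : measurable_fun [set: R] (fun x : R => x `^ a)%R by exact: measurable_powR.
  have mfp := measurableT_comp mfZ (@measurable_snd _ _ (measurableTypeR R) Om).
  exact: (measurableT_comp mp mfp).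
apply: emeasurable_funM.
  by apply/measurable_EFinP; exact: mpow.
apply: (measurableT_comp mg); apply: measurable_scale_comp.
  apply: measurable_funM; first exact: measurable_fst.
  apply: measurable_funV_ge0 => //.
  exact: (measurableT_comp mfZ (@measurable_snd _ _ (measurableTypeR R) Om)).
by apply: (measurableT_comp mZ); exact: measurable_snd.
Qed.

(** The mixture of the laws of [u Z], with the density absorbed into theta. *)
Definition spectral_measure (A : set D) : \bar R :=
  \int[theta]_u P [set w | A (cadlag_scale u (Z w))].

Lemma spectral_measureE A : measurable A ->
  spectral_measure A = (theta \x P) ((fun p => cadlag_scale p.1 (Z p.2)) @^-1` A).
Proof.
move=> mA; rewrite /product_measure1; apply: eq_integral => u _ /=.
by congr (P _); apply/seteqP; split => w; rewrite /xsection/= inE.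
Qed.

Lemma spectral_measure_is_measure : exists m : {measure set D -> \bar R},
  forall A, measurable A -> m A = spectral_measure A.
Proof.
exists (measure_function_pushforward__canonical__measure_function_Measure
  (theta \x P) mF) => A mA.
by rewrite spectral_measureE.
Qed.

Variable nu : {measure set D -> \bar R}.
Hypothesis nuE : forall A, measurable A -> nu A = spectral_measure A.

Lemma integral_spectral (g : D -> \bar R) : measurable_fun setT g ->
  (forall y, 0 <= g y) ->
  \int[nu]_y g y = \int[theta]_u \int[P]_w g (cadlag_scale u (Z w)).
Proof.
move=> mg g0.
have mgF := measurableT_comp mg mF.
transitivity (\int[pushforward (theta \x P) (fun p => cadlag_scale p.1 (Z p.2))]_y g y).
  by apply: eq_measure_integral => A mA _; rewrite nuE// spectral_measureE.
rewrite (ge0_integral_pushforward mF)//.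
rewrite preimage_setT (fubini_tonelli1 _ mgF)// => p; exact: g0.
Qed.

(* Substitute [u = v / f (Z w)]. *)
Lemma integral_spectral_polar (f : D -> R) (g : D -> \bar R) :
  measurable_fun setT f -> (forall y, 0 <= f y)%R ->
  (forall t y, (0 < t)%R -> f (cadlag_scale t y) = (t * f y)%R) ->
  measurable_fun setT g -> (forall y, 0 <= g y) ->
  (forall y, f y = 0%R -> g y = 0) ->
  \int[nu]_y g y = \int[theta]_v \int[P]_w
    ((f (Z w) `^ alpha)%:E * g (cadlag_scale (v / f (Z w)) (Z w))).
Proof.
move=> mf f0 fZ mg g0 fg.
have mfZ := measurableT_comp mf mZ.
have mgF := measurableT_comp mg mF.
have mX (w : Om) (c : R) : measurable_fun [set: measurableTypeR R]
    (fun v => g (cadlag_scale (v / c) (Z w))).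
  apply: (measurableT_comp mg); apply: measurable_scale_comp => //.
  exact: measurable_funM.
have mG := measurable_polar mf f0 mg.
rewrite integral_spectral//.
rewrite (fubini_tonelli (m1 := theta) (m2 := P) (fun p => g (cadlag_scale p.1 (Z p.2))))//.
rewrite (fubini_tonelli (m1 := theta) (m2 := P) (fun p =>
    (f (Z p.2) `^ alpha)%:E * g (cadlag_scale (p.1 / f (Z p.2)) (Z p.2))))//; last first.
  by move=> p; rewrite mule_ge0// lee_fin powR_ge0.
(* With [w] now fixed, either [f (Z w) = 0] and both sides vanish, or dilating the variable by
   [f (Z w)] produces the factor [f (Z w)^alpha]. *)
apply: eq_integral => w _ /=.
have := f0 (Z w); rewrite le_eqVlt => /predU1P[f00|n0].
  rewrite -f00 powR0 ?gt_eqF//.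
  under [RHS]eq_integral do rewrite mul0e.
  rewrite integral0; apply: ge0_integral_pareto_eq0 => //.
    apply: (measurableT_comp mg); exact: measurable_scale_comp.
  by move=> u u0; apply: fg; rewrite fZ// -f00 mulr0.
rewrite ge0_integralZl ?lee_fin ?powR_ge0//.
rewrite -(pareto_measure_scale halpha n0 (mX w (f (Z w))))//.
by apply: eq_integral => u _; rewrite mulrAC divff ?gt_eqF// mul1r.
Qed.

End spectral_representation.

(** * Suprema of paths over compact intervals *)

Section suprema.
Local Open Scope ereal_scope.
Context {R : realType} {d : nat} {N : 'rV[R]_d -> R} (hN : is_norm N).
Local Notation D := (cadlag R d).

(** A monotone bijection of the nonnegative reals commutes with a finite supremum; it serves for
    multiplication by [t] and for the power [alpha]. *)
Lemma sup_on_comp (a b M : R) (f phi psi : R -> R) : (a <= b)%R ->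
  (forall s, 0 <= f s)%R ->
  {in Num.nneg &, {homo phi : x y / (x <= y)%R}} ->
  {in Num.nneg &, {homo psi : x y / (x <= y)%R}} ->
  (forall x, 0 <= x -> 0 <= phi x)%R -> (forall x, 0 <= x -> 0 <= psi x)%R ->
  (forall x, 0 <= x -> psi (phi x) = x)%R ->
  (forall x, 0 <= x -> phi (psi x) = x)%R ->
  sup_on a b f = M%:E -> sup_on a b (phi \o f) = (phi M)%:E.
Proof.
move=> ab f0 hphi hpsi phi0 psi0 psiK phiK fM.
have fle s : (a <= s <= b)%R -> (f s <= M)%R.
  by move=> sab; rewrite -lee_fin -fM; apply: ereal_sup_ubound; exists s => //; rewrite /= in_itv.
have M0 : (0 <= M)%R by apply: le_trans (f0 a) (fle a _); rewrite lexx.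
apply/eqP; rewrite eq_le; apply/andP; split.
  apply: ge_ereal_sup => _ [s sab <-]; rewrite lee_fin hphi ?nnegrE//; apply: fle.
  by move: sab; rewrite /= in_itv.
rewrite leNgt; apply/negP => lt.
have : 0 <= sup_on a b (phi \o f).
  apply: (@le_trans _ _ (phi (f a))%:E); first by rewrite lee_fin phi0.
  by apply: ereal_sup_ubound; exists a => //; rewrite /= in_itv/= lexx.
case E : (sup_on a b (phi \o f)) lt => [c| |] //; rewrite lte_fin lee_fin => cM c0.
(* If the supremum were [c < phi M], then [psi c] would be an upper bound of [f], whence
   [M <= psi c] and [phi M <= c]. *)
suff : M%:E <= (psi c)%:E.
  rewrite lee_fin => Mc; have := hphi M (psi c).
  by rewrite !nnegrE M0 psi0// phiK// => /(_ isT isT Mc); rewrite leNgt cM.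
rewrite -fM; apply: ge_ereal_sup => _ [s sab <-].
rewrite lee_fin -[leLHS]psiK//; apply: hpsi; rewrite ?nnegrE ?phi0//.
by rewrite -lee_fin -E; apply: ereal_sup_ubound; exists s.
Qed.

Definition cadlag_sup (a b : R) (y : D) : R := fine (sup_on a b (fun s => N (y s))).

(** [fine] loses nothing: paths are bounded on compact intervals and [N] is Lipschitz. *)
Lemma cadlag_supE (a b : R) (y : D) : (a <= b)%R ->
  sup_on a b (fun s => N (y s)) = (cadlag_sup a b y)%:E.
Proof.
move=> ab; rewrite fineK// fin_numElt; apply/andP; split.
  apply: (@lt_le_trans _ _ (N (y a))%:E); first exact: ltNyr.
  by apply: ereal_sup_ubound; exists a => //; rewrite /= in_itv/= lexx.
have [C C0 NC] := norm_lipschitz hN.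
have [K K0 yK] := cadlag_bounded y (Num.max `|a| `|b|)%R.
apply: (@le_lt_trans _ _ (C * K)%:E); last exact: ltry.
apply: ge_ereal_sup => _ [s + <-]; rewrite /= in_itv/= => /andP[sa sb].
rewrite lee_fin; have := NC (y s) 0%R; rewrite (norm0 hN) !subr0 => /le_trans; apply.
rewrite ler_pM2l// yK// le_max.
have [s0|s0] := leP 0%R s.
  by rewrite ger0_norm// (le_trans sb (ler_norm _)) orbT.
by rewrite ltr0_norm// (ler0_norm (ltW (le_lt_trans sa s0))) lerN2 sa.
Qed.

Lemma cadlag_sup_ge (a b s : R) (y : D) : (a <= s <= b)%R ->
  (N (y s) <= cadlag_sup a b y)%R.
Proof.
move=> /andP[sa sb]; rewrite -lee_fin -cadlag_supE ?(le_trans sa)//.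
by apply: ereal_sup_ubound; exists s => //; rewrite /= in_itv/= sa sb.
Qed.

Lemma cadlag_sup_ge0 (a b : R) (y : D) : (a <= b)%R -> (0 <= cadlag_sup a b y)%R.
Proof.
by move=> ab; rewrite (le_trans (norm_ge0 hN (y a)))// cadlag_sup_ge// lexx.
Qed.

Lemma cadlag_sup_scale (a b t : R) (y : D) : (a <= b)%R -> (0 < t)%R ->
  cadlag_sup a b (cadlag_scale t y) = (t * cadlag_sup a b y)%R.
Proof.
move=> ab t0; apply: EFin_inj; rewrite -cadlag_supE//.
rewrite -(@sup_on_comp a b (cadlag_sup a b y) (fun s => N (y s)) ( *%R t) ( *%R t^-1))//.
- by congr sup_on; apply/funext => s /=; rewrite (normZ hN) gtr0_norm.
- by move=> s; exact: norm_ge0.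
- by move=> x z _ _ xz; rewrite ler_pM2l.
- by move=> x z _ _ xz; rewrite ler_pM2l ?invr_gt0.
- by move=> x x0; rewrite mulr_ge0// ltW.
- by move=> x x0; rewrite mulr_ge0// invr_ge0 ltW.
- by move=> x _; rewrite mulKf ?gt_eqF.
- by move=> x _; rewrite mulVKf ?gt_eqF.
- exact: cadlag_supE.
Qed.

Lemma sup_on_powR (a b alpha : R) (y : D) : (a <= b)%R -> (0 < alpha)%R ->
  sup_on a b (fun s => N (y s) `^ alpha)%R = (cadlag_sup a b y `^ alpha)%:E.
Proof.
move=> ab a0.
apply: (@sup_on_comp a b (cadlag_sup a b y) (fun s => N (y s)) (fun x => x `^ alpha)%R
  (fun x => x `^ alpha^-1)%R) => //.
- by move=> s; exact: norm_ge0.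
- exact: ge0_ler_powR (ltW a0).
- by apply: ge0_ler_powR; rewrite invr_ge0 ltW.
- by move=> x _; exact: powR_ge0.
- by move=> x _; exact: powR_ge0.
- by move=> x x0; rewrite -powRrM divff ?gt_eqF// powRr1.
- by move=> x x0; rewrite -powRrM mulVf ?gt_eqF// powRr1.
- exact: cadlag_supE.
Qed.

Lemma measurable_cadlag_sup (a b : R) : (a <= b)%R ->
  measurable_fun [set: D] (cadlag_sup a b).
Proof.
move=> ab mD; apply: (measurability _ (RGenOInfty.measurableE R)) => //.
move=> _ [_ [c ->] <-]; rewrite setTI.
rewrite (_ : _ @^-1` _ = [set y : D | c%:E < sup_on a b (fun t => N (y t))]).
  exact: measurable_gt_sup_on.
by apply/seteqP; split => y; rewrite /= in_itv/= andbT cadlag_supE.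
Qed.

Lemma separated_sub (A : set D) : separated_from0 N A ->
  exists a b e : R, [/\ (a < b)%R, (0 < e)%R & A `<=` [set y | (e < cadlag_sup a b y)%R]].
Proof.
(* Enlarging the interval only raises the supremum, and makes it nondegenerate, as the moment
   condition on spectral processes asks [a < b]. *)
move=> [a [b [ab inf0]]]; exists a, (b + 1)%R.
have [e e0 eH] : exists2 e : R, (0 < e)%R &
    e%:E < ereal_inf [set sup_on a b (fun t => N (y t)) | y in A].
  case: ereal_inf inf0 => [r| |]//; last by exists 1%R => //; exact: ltry.
  by rewrite lte_fin => r0; exists (r / 2)%R; rewrite ?lte_fin; lra.
exists e; split => //; first by lra.
move=> y Ay /=; rewrite -lte_fin.
apply: (@lt_le_trans _ _ (sup_on a b (fun t => N (y t)))).
  by apply: (lt_le_trans eH); apply: ereal_inf_lbound; exists y.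
apply: ge_ereal_sup => _ [s + <-]; rewrite /= in_itv/= => /andP[sa sb].
by rewrite lee_fin cadlag_sup_ge// sa/=; lra.
Qed.

Lemma cadlag_sup_separated (a b e : R) : (a <= b)%R -> (0 < e)%R ->
  separated_from0 N [set y | (e < cadlag_sup a b y)%R].
Proof.
move=> ab e0; exists a, b; split => //.
apply: (@lt_le_trans _ _ e%:E); first by rewrite lte_fin.
apply: le_ereal_inf_tmp => _ [y /= ey <-].
by rewrite cadlag_supE// lee_fin ltW.
Qed.

End suprema.

(** * Measures given by a spectral representation *)

Section spectral_consequences.
Local Open Scope ereal_scope.
Context {R : realType} {d : nat} {N : 'rV[R]_d -> R} (hN : is_norm N).
Context {alpha : R} (halpha : (0 < alpha)%R).
Local Notation D := (cadlag R d).
Local Notation theta := (pareto_measure halpha).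
Context {disp} {Om : measurableType disp} (P : probability Om R) (Z : Om -> D).
Hypothesis mZ : measurable_fun setT Z.
Local Notation rho := (spectral_measure halpha P Z).

Lemma measurable_scale_law A : measurable A ->
  measurable_fun [set: measurableTypeR R] (fun u => P [set w | A (cadlag_scale u (Z w))]).
Proof.
move=> mA.
have mF : measurable_fun [set: measurableTypeR R * Om] (fun p => cadlag_scale p.1 (Z p.2)).
  apply: measurable_scale_comp; first exact: measurable_fst.
  by apply: (measurableT_comp mZ); exact: measurable_snd.
have mFA : measurable ((fun p : measurableTypeR R * Om => cadlag_scale p.1 (Z p.2)) @^-1` A).
  by rewrite -[X in measurable X]setTI; exact: mF.
have := measurable_fun_xsection P mFA; congr measurable_fun.
by apply/funext => u /=; congr (P _); apply/seteqP; split => w; rewrite /xsection/= inE.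
Qed.

(** Links the Lebesgue integral in the definition of a spectral process to theta: the weighted law
    with weight 1 is the law of [u Z]. *)
Lemma spectral_formulaE A : measurable A ->
  \int[lebesgue_measure]_(u in `]0%R, +oo[%classic)
    (weighted_law P (cst 1%R) (fun w => cadlag_scale u (Z w)) A
     * (alpha * u `^ (- alpha - 1))%:E) = rho A.
Proof.
move=> mA; rewrite /spectral_measure integral_pareto_measure//; last exact: measurable_scale_law.
apply: eq_integral => u _; congr (_ * _); rewrite /weighted_law.
have mS : measurable [set w | A (cadlag_scale u (Z w))].
  by rewrite -[X in measurable X]setTI; exact: (measurable_scale_comp (measurable_cst u) mZ).
transitivity (\int[P]_w (\1_[set w | A (cadlag_scale u (Z w))] w)%:E); last first.
  by rewrite integral_indic ?setIT.
apply: eq_integral => w _; rewrite mul1e diracE indicE /=; congr (_%:R%:E); apply/idP/idP; rewrite !inE.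
Qed.

(** Dilating [A] by [t] amounts to replacing [u] by [u / t], which theta turns into the factor
    [t^(-alpha)]. *)
Lemma spectral_measure_homogeneous t A : (0 < t)%R -> measurable A ->
  rho (cadlag_scale t @` A) = (t `^ (- alpha))%:E * rho A.
Proof.
move=> t0 mA; have t'0 : (0 < t^-1)%R by rewrite invr_gt0.
have := pareto_measure_scale halpha t'0 (measurable_scale_law mA) (fun u => measure_ge0 P _).
rewrite -(powR_inv1 (ltW t0)) -powRrM mulN1r => <-.
apply: eq_integral => u _; rewrite image_scaleE//; congr (P _).
by apply/seteqP; split => w /=; rewrite cadlag_scaleA powR_inv1 ?(ltW t0).
Qed.

Lemma spectral_measure0 : P (Z @^-1` [set cadlag0]) = 0 -> rho [set cadlag0] = 0.
Proof.
move=> Z0; apply: ge0_integral_pareto_eq0 => //.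
  exact: measurable_scale_law (measurable_cadlag0 hN).
move=> u u0; rewrite -[RHS]Z0; congr (P _); apply/seteqP; split => w /= H.
  rewrite -(cadlag_scale1 (Z w)) -(@mulVf _ u) ?gt_eqF// -cadlag_scaleA H.
  by apply: cadlag_eq => s /=; rewrite scaler0.
by rewrite H; apply: cadlag_eq => s /=; rewrite scaler0.
Qed.

Variable nu : {measure set D -> \bar R}.
Hypothesis nuE : forall A, measurable A -> nu A = rho A.

(** In the polar formula [f] takes the value [v] at [v Z / f(Z)] and [H] ignores the scaling, so the
    indicator of [f > 1] becomes that of [v > 1], of theta mass 1. *)
Lemma integral_spectral_gt1 (f H : D -> R) :
  measurable_fun setT f -> (forall y, 0 <= f y)%R ->
  (forall t y, (0 < t)%R -> f (cadlag_scale t y) = (t * f y)%R) ->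
  measurable_fun setT H -> (forall y, 0 <= H y)%R ->
  (forall t y, (0 < t)%R -> H (cadlag_scale t y) = H y) ->
  \int[nu]_y ((H y)%:E * (\1_[set y | (1 < f y)%R] y)%:E) =
  \int[P]_w (f (Z w) `^ alpha * H (Z w))%:E.
Proof.
move=> mf f0 fZ mH H0 HZ.
have mI : measurable [set y | (1 < f y)%R].
  rewrite -[X in measurable X]setTI.
  have -> : [set y | (1 < f y)%R] = f @^-1` `]1%R, +oo[%classic.
    by apply/seteqP; split => y; rewrite /= in_itv/= andbT.
  exact: mf.
pose c := \int[P]_w (f (Z w) `^ alpha * H (Z w))%:E.
have c0 : 0 <= c.
  by apply: integral_ge0 => w _; rewrite lee_fin mulr_ge0 ?powR_ge0.
have mHI : measurable_fun setT (fun y => (H y)%:E * (\1_[set y | (1 < f y)%R] y)%:E).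
  by apply: emeasurable_funM; apply/measurable_EFinP => //; exact: measurable_indic.
(* Writing the constant [c] as an integral over [v] allows a comparison of integrands. *)
have I1 : \int[theta]_v (c * (\1_`]1%R, +oo[%classic v)%:E) = c.
  have mI1 : measurable_fun [set: measurableTypeR R]
      (fun v : measurableTypeR R => (\1_`]1%R, +oo[%classic v : R)%:E).
    by apply/measurable_EFinP; exact: measurable_indic.
  rewrite (ge0_integralZl _ measurableT mI1 _ c0); last by move=> v _; rewrite lee_fin.
  have -> : \int[theta]_v (\1_`]1%R, +oo[%classic v)%:E = theta `]1%R, +oo[.
    by rewrite integral_indic ?setIT.
  by rewrite pareto_measure_gt1 mule1.
rewrite -/c -[RHS]I1 (integral_spectral_polar mZ nuE mf f0 fZ mHI)//; last 2 first.
- by move=> y; rewrite mule_ge0 ?lee_fin.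
- by move=> y fy0; rewrite indicE memNset ?mule0//= fy0 ltr10.
apply: ge0_eq_integral_pareto => //.
- apply: (measurable_fun_fubini_tonelli_F (m2 := P) _ (measurable_polar mZ mf f0 mHI)).
  by move=> p; rewrite !mule_ge0 ?lee_fin ?powR_ge0.
- by apply: emeasurable_funM => //; apply/measurable_EFinP; exact: measurable_indic.
- by move=> v; apply: integral_ge0 => w _; rewrite !mule_ge0 ?lee_fin ?powR_ge0.
- by move=> v; rewrite mule_ge0 ?lee_fin.
move=> v v0; rewrite /c -ge0_integralZr//.
- apply: eq_integral => w _; rewrite EFinM -!muleA.
  have := f0 (Z w); rewrite le_eqVlt => /predU1P[<-|n0].
    by rewrite powR0 ?gt_eqF// !mul0e.
  rewrite HZ ?divr_gt0//; congr (_ * (_ * _)).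
  have E : f (cadlag_scale (v / f (Z w)) (Z w)) = v.
    by rewrite fZ ?divr_gt0// divfK ?gt_eqF.
  rewrite !indicE; congr ((nat_of_bool _)%:R%:E).
  by apply/idP/idP; rewrite !inE/= in_itv/= andbT E.
- apply/measurable_EFinP; apply: measurable_funM; last exact: measurableT_comp.
  have mp : measurable_fun [set: R] (fun x : R => x `^ alpha)%R by exact: measurable_powR.
  exact: (measurableT_comp mp (measurableT_comp mf mZ)).
- by move=> w _; rewrite lee_fin mulr_ge0 ?powR_ge0.
Qed.

End spectral_consequences.

(** * From a spectral process to a shift-invariant tail measure *)

Section spectral_tail_measure.
Local Open Scope ereal_scope.
Context {R : realType} {d : nat} {N : 'rV[R]_d -> R} (hN : is_norm N).
Local Notation D := (cadlag R d).

Lemma measurable_preimage_gt (f : D -> R) (c : R) : measurable_fun setT f ->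
  measurable [set y | (c < f y)%R].
Proof.
move=> mf; rewrite -[X in measurable X]setTI.
have -> : [set y | (c < f y)%R] = f @^-1` `]c, +oo[%classic.
  by apply/seteqP; split => y; rewrite /= in_itv/= andbT.
exact: mf.
Qed.

Lemma norm_eval_scale (s t : R) (y : D) : (0 < t)%R ->
  N (cadlag_scale t y s) = (t * N (y s))%R.
Proof. by move=> t0; rewrite /= (normZ hN) gtr0_norm. Qed.

(** The null path and the sets [[N (y s) > 0]] with [s] rational form a countable cover. *)
Lemma eq_cadlag_measure (m1 m2 : {measure set D -> \bar R}) :
  m1 [set cadlag0] = 0 -> m2 [set cadlag0] = 0 ->
  (forall s (A : set D), measurable A -> A `<=` [set y | (0 < N (y s))%R] -> m1 A = m2 A) ->
  forall A, measurable A -> m1 A = m2 A.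
Proof.
move=> m10 m20 m12 A mA.
pose F i := if i is j.+1 then [set y : D | (0 < N (y (ratq j)))%R] else [set cadlag0].
apply: (@eq_measure_bigcup _ _ _ m1 m2 F) => //.
- move=> [|i]; first exact: (measurable_cadlag0 hN).
  by apply: measurable_preimage_gt; exact: (measurable_eval hN).
- move=> [|i] B mB BF; last exact: m12 BF.
  have null (m : {measure set D -> \bar R}) : m [set cadlag0] = 0 -> m B = 0.
    by apply: subset_measure0 => //; exact: (measurable_cadlag0 hN).
  by rewrite !null.
- move=> y _; have [->|/(cadlag_neq0 hN)[i yi]] := pselect (y = cadlag0).
    by exists 0%N.
  by exists i.+1.
Qed.

Context {alpha : R} (halpha : (0 < alpha)%R).
Local Notation theta := (pareto_measure halpha).
Context {nu : {measure set D -> \bar R}}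
  {disp} {Om : measurableType disp} {P : probability Om R} {Z : {RV P >-> D}}.
Hypothesis spZ : spectral_process N alpha nu Z.

Let mZ : measurable_fun setT Z. Proof. exact: measurable_funP. Qed.

Lemma spectral_processE A : measurable A -> nu A = spectral_measure halpha P Z A.
Proof. by case: spZ => _ _ nuE _ mA; rewrite nuE// spectral_formulaE. Qed.

Lemma spectral_homogeneous : homogeneous_measure alpha nu.
Proof.
move=> t A t0 mA; rewrite !spectral_processE//.
  exact: spectral_measure_homogeneous.
exact: measurable_image_scale.
Qed.

Lemma spectral_cadlag0 : nu [set cadlag0] = 0.
Proof.
rewrite spectral_processE; last exact: (measurable_cadlag0 hN).
by apply: (spectral_measure0 hN) => //; case: spZ.
Qed.

Lemma spectral_gt1 (f : D -> R) :
  measurable_fun setT f -> (forall y, 0 <= f y)%R ->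
  (forall t y, (0 < t)%R -> f (cadlag_scale t y) = (t * f y)%R) ->
  nu [set y | (1 < f y)%R] = \int[P]_w (f (Z w) `^ alpha)%:E.
Proof.
move=> mf f0 fZ.
have := @integral_spectral_gt1 _ _ _ halpha _ _ P Z mZ nu spectral_processE f (cst 1%R) mf f0 fZ.
move=> /(_ (measurable_cst _) (fun _ => ler01) (fun _ _ _ => erefl)).
under eq_integral do rewrite mul1e.
rewrite integral_indic ?setIT//; last exact: measurable_preimage_gt.
by move=> ->; apply: eq_integral => w _; rewrite mulr1.
Qed.

Lemma spectral_tail_measure : tail_measure N alpha nu.
Proof.
split.
- split; first exact: spectral_cadlag0.
  move=> A mA /(separated_sub hN)[a [b [e [ab e0 Ae]]]].
  have mS := measurable_cadlag_sup hN (ltW ab).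
  have m1 := measurable_preimage_gt 1%R mS.
  (* Homogeneity brings [[sup > e]] back to [[sup > 1]], whose mass is the moment of the supremum of
     [Z]. *)
  have Ae' : A `<=` cadlag_scale e @` [set y | (1 < cadlag_sup (N := N) a b y)%R].
    rewrite image_scaleE// => y /Ae /= ey.
    by rewrite (cadlag_sup_scale hN) ?ltW ?invr_gt0// -ltr_pdivrMl ?invr_gt0// invrK mulr1.
  apply: (@le_lt_trans _ _ (nu (cadlag_scale e @` [set y | (1 < cadlag_sup (N := N) a b y)%R]))).
    by apply: le_measure; rewrite ?inE//; exact: measurable_image_scale.
  rewrite spectral_homogeneous// (spectral_gt1 mS); last 2 first.
  + by move=> y; apply: (cadlag_sup_ge0 hN); exact: ltW.
  + by move=> t y t0; apply: (cadlag_sup_scale hN) => //; exact: ltW.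
  rewrite lte_mul_pinfty ?lee_fin ?powR_ge0//.
  (* Only the moment bound is wanted here, so [H = 0] and [t = 0] will do. *)
  case: spZ => _ _ _ /(_ a b 0%R (cst 0%R) ab)[] //.
  + exists 0%R; split; first exact: num_real.
    by move=> M M0 y _; rewrite /= normr0; exact: ltW.
  + by move=> t y t0; rewrite /= mulr0.
  move=> /andP[_ + _]; congr (_ < _); apply: eq_integral => w _.
  by rewrite (sup_on_powR hN)// ltW.
- exact: spectral_cadlag0.
- rewrite /exceedance (@spectral_gt1 (fun y => N (y 0%R))).
  + by case: spZ => _ E _ _; rewrite -E unlock.
  + exact: (measurable_eval hN).
  + by move=> y; exact: norm_ge0.
  + by move=> t y; exact: norm_eval_scale.
- exact: spectral_homogeneous.
Qed.

Lemma spectral_shift_invariant : shift_invariant nu.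
Proof.
(* The polar formula is used with [f = N (y s)] for [A] and with [f = N (y 0)] for its preimage; for
   each [v] the two expectations agree by the time change formula for [Z]. *)
have key s (A : set D) : measurable A -> A `<=` [set y | (0 < N (y s))%R] ->
    nu A = nu (cadlag_shift s @^-1` A).
  move=> mA A0.
  have mIA : measurable_fun setT (fun y => (\1_A y : R)%:E).
    by apply/measurable_EFinP; exact: measurable_indic.
  have mB : measurable (cadlag_shift s @^-1` A).
    by rewrite -[X in measurable X]setTI; exact: measurable_shift.
  have mIB : measurable_fun setT (fun y => (\1_(cadlag_shift s @^-1` A) y : R)%:E).
    by apply/measurable_EFinP; exact: measurable_indic.
  have nuI B : measurable B -> nu B = \int[nu]_y (\1_B y)%:E.
    by move=> ?; rewrite integral_indic ?setIT.
  rewrite (nuI A)// (nuI (cadlag_shift s @^-1` A))//.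
  rewrite (integral_spectral_polar mZ spectral_processE (measurable_eval hN s) _ _ mIA); last 4 first.
  - by move=> y; exact: norm_ge0.
  - by move=> t y; exact: norm_eval_scale.
  - by move=> y; rewrite lee_fin.
  - by move=> y y0; rewrite indicE memNset// => /A0 /=; rewrite y0 ltxx.
  rewrite (integral_spectral_polar mZ spectral_processE (measurable_eval hN 0%R) _ _ mIB); last 4 first.
  - by move=> y; exact: norm_ge0.
  - by move=> t y; exact: norm_eval_scale.
  - by move=> y; rewrite lee_fin.
  - by move=> y y0; rewrite indicE memNset// => /A0 /=; rewrite subrr y0 ltxx.
  apply: eq_integral => v _.
  (* Dividing by [N (y s)] makes this indicator 0-homogeneous. *)
  pose H (y : D) : R := \1_A (cadlag_scale (v / N (y s)) y).
  case: spZ => _ _ _ /(_ 0%R 1%R s H ltr01)[].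
  - have mA1 : measurable_fun [set: D] (\1_A : D -> R) by exact: measurable_indic.
    apply: (measurableT_comp mA1).
    apply: measurable_scale_comp => //; apply: measurable_funM => //.
    apply: measurable_funV_ge0; first exact: (measurable_eval hN).
    by move=> y; exact: norm_ge0.
  - exists 1%R; split; first exact: num_real.
    move=> M M1 y _ /=; rewrite /H indicE; case: (_ \in _) => /=.
      by rewrite normr1 ltW.
    by rewrite normr0 ltW// (lt_trans ltr01).
  - move=> t y t0; rewrite /H powRr0 mul1r norm_eval_scale// cadlag_scaleA.
    congr (\1_A (cadlag_scale _ y)); rewrite -mulrA; congr (_ * _)%R.
    by rewrite invfM mulrAC mulVf ?gt_eqF// mul1r.
  move=> _; rewrite unlock => E.
  under eq_integral do rewrite -EFinM.
  rewrite [LHS]E; apply: eq_integral => w _.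
  rewrite /H /= subrr EFinM !indicE; congr (_ * (nat_of_bool _)%:R%:E).
  by apply/idP/idP; rewrite !inE /= cadlag_shift_scale.
move=> t A mA.
have mt : measurable_fun [set: D] (cadlag_shift t) by exact: measurable_shift.
apply: (@eq_cadlag_measure (pushforward nu (cadlag_shift t)) nu) => //.
- rewrite /pushforward -[RHS]spectral_cadlag0; congr (nu _).
  apply/seteqP; split => y /= H; last by rewrite H; exact: cadlag_eq.
  rewrite -(cadlag_shift0 y) -(addNr t) -cadlag_shiftD H.
  exact: cadlag_eq.
- exact: spectral_cadlag0.
(* [key] at [s - t] for the preimage and at [s] for [B] lead to the same shifted set. *)
- move=> s B mB B0; transitivity (nu (cadlag_shift t @^-1` B)) => //.
  have mtB : measurable (cadlag_shift t @^-1` B).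
    by rewrite -[X in measurable X]setTI; exact: measurable_shift.
  rewrite (key (s - t)%R _ mtB); last by move=> y /B0.
  rewrite (key s B mB B0); congr (nu _); apply/seteqP.
  by split => y /=; rewrite cadlag_shiftD subrKC.
Qed.

End spectral_tail_measure.

(** * The tail process: uniqueness and law *)

Section tail_process_law.
Local Open Scope ereal_scope.
Context {R : realType} {d : nat} {N : 'rV[R]_d -> R} (hN : is_norm N).
Local Notation D := (cadlag R d).

Lemma exceedance_scale (t : R) : (0 < t)%R ->
  cadlag_scale t @` exceedance N = [set y : D | (t < N (y 0%R))%R].
Proof.
move=> t0; rewrite image_scaleE//; apply/seteqP; split => y;
  by rewrite /exceedance /= -/(cadlag_scale t^-1 y 0%R) (norm_eval_scale hN) ?invr_gt0//
    -ltr_pdivrMl ?invr_gt0// invrK mulr1.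
Qed.

Lemma measurable_exceedance : measurable (exceedance N : set D).
Proof. exact: measurable_preimage_gt (measurable_eval hN 0%R). Qed.

(** The index is read off the mass [2^(-alpha)] of [[N (y 0) > 2]]. Homogeneity then extends the
    equality to [[N (y 0) > 0]], and shift invariance to every [[N (y s) > 0]]. *)
Lemma tail_measure_unique (alpha alpha' : R) (nu nu' : {measure set D -> \bar R}) :
  tail_measure N alpha nu -> shift_invariant nu ->
  tail_measure N alpha' nu' -> shift_invariant nu' ->
  (forall A, measurable A -> nu (A `&` exceedance N) = nu' (A `&` exceedance N)) ->
  forall A, measurable A -> nu A = nu' A.
Proof.
move=> [_ nu0 nuE hnu] snu [_ nu'0 nu'E hnu'] snu' nunu'.
have mE := measurable_exceedance.
have aa : alpha = alpha'.
  have sub : cadlag_scale 2 @` exceedance N `<=` (exceedance N : set D).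
    by rewrite exceedance_scale// => y /=; apply: lt_trans; rewrite ltr1n.
  have := nunu' (cadlag_scale 2 @` exceedance N) (measurable_image_scale (ltr0n _ 2) mE).
  rewrite setIidl// hnu// hnu'// nuE nu'E !mule1 => -[/(congr1 (@ln R))].
  rewrite !ln_powR => /mulIf; rewrite gt_eqF ?ln_gt0 ?ltr1n// => /(_ isT).
  exact: oppr_inj.
subst alpha'.
apply: (eq_cadlag_measure hN) => // s A mA A0.
have mA' : measurable (cadlag_shift s @^-1` A).
  by rewrite -[X in measurable X]setTI; exact: measurable_shift.
rewrite -(snu s)// -(snu' s)// /pushforward.
apply: (eq_homogeneous_measure hnu hnu' (measurable_eval hN 0%R)) => //.
- by move=> t y; exact: norm_eval_scale.
- by move=> B mB BE; rewrite -(setIidl BE); exact: nunu'.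
- by move=> y /A0 /=; rewrite subrr.
Qed.

Context {alpha : R} (halpha : (0 < alpha)%R).

(** The polar formula with [f = N (y 0)] and the joint law of [(W, Z)] turn the two sides into
    integrals against theta with the same integrand for [u > 0]. *)
Lemma tail_process_law {nu : {measure set D -> \bar R}}
    {disp} {Om : measurableType disp} {P : probability Om R} {Z : {RV P >-> D}}
    {W : {RV P >-> R}} :
  spectral_process N alpha nu Z -> pareto alpha W -> independent_rv W Z ->
  forall A, measurable A -> nu (A `&` exceedance N) =
    weighted_law P (fun w => N (Z w 0%R) `^ alpha)%R
      (fun w => cadlag_scale (W w / N (Z w 0%R)) (Z w)) A.
Proof.
move=> spZ paretoW indep A mA.
have mZ : measurable_fun setT Z by exact: measurable_funP.
have mW : measurable_fun [set: Om] (W : Om -> measurableTypeR R).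
  exact: (@measurable_funP _ _ _ _ _ W).
pose f (y : D) := N (y 0%R).
have mf : measurable_fun [set: D] f by exact: (measurable_eval hN).
have f0 y : (0 <= f y)%R by exact: norm_ge0.
have mE := measurable_exceedance.
have mI (B : set D) : measurable B -> measurable_fun setT (fun y : D => (\1_B y : R)%:E).
  by move=> mB; apply/measurable_EFinP; exact: measurable_indic.
have mAE : measurable (A `&` exceedance N) by exact: measurableI.
pose g (p : measurableTypeR R * D) :=
  (f p.2 `^ alpha)%:E * (\1_A (cadlag_scale (p.1 / f p.2) p.2) : R)%:E.
have mg : measurable_fun setT g.
  exact: (@measurable_polar _ _ alpha _ D idfun (@measurable_id _ D setT) f _ mf f0 (mI A mA)).
have g0 p : 0 <= g p by rewrite mule_ge0 ?lee_fin ?powR_ge0.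
have WZ (r : R) S : (1 <= r)%R -> measurable S ->
    P [set w | (r < W w)%R /\ S (Z w)] = (r `^ (- alpha))%:E * P (Z @^-1` S).
  move=> r1 mS; rewrite -paretoW//.
  have <- : W @^-1` `]r, +oo[%classic = [set w | (r < W w)%R].
    by apply/seteqP; split => w; rewrite /= in_itv/= andbT.
  by rewrite -indep//; congr (P _); apply/seteqP; split => w; rewrite /= in_itv/= andbT.
transitivity (\int[P]_w g (W w, Z w)); last first.
  by apply: eq_integral => w _; rewrite /g diracE indicE.
rewrite (pareto_joint_law halpha mW mZ WZ mg g0).
transitivity (\int[nu]_y (\1_(A `&` exceedance N) y)%:E).
  by rewrite integral_indic ?setIT.
have hf t y : (0 < t)%R -> f (cadlag_scale t y) = (t * f y)%R.
  exact: norm_eval_scale.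
rewrite (integral_spectral_polar mZ (spectral_processE halpha spZ) mf f0 hf (mI _ mAE)); last 2 first.
- by move=> y; rewrite lee_fin.
- move=> y fy; rewrite indicE memNset// => -[_].
  by rewrite /exceedance /= -/(f y) fy ltr10.
have mgZ (u : measurableTypeR R) : measurable_fun setT (fun w => g (u, Z w)).
  apply: (measurableT_comp mg); exact: measurable_fun_pair.
apply: ge0_eq_integral_pareto.
- apply: (measurable_fun_fubini_tonelli_F (m2 := P) _ (measurable_polar mZ mf f0 (mI _ mAE))).
  by move=> p; rewrite mule_ge0 ?lee_fin ?powR_ge0.
- apply: emeasurable_funM; last by apply/measurable_EFinP; exact: measurable_indic.
  have mp : measurable_fun [set: measurableTypeR R * Om] (fun p => g (p.1, Z p.2)).
    apply: (measurableT_comp mg); apply: measurable_fun_pair; first exact: measurable_fst.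
    by apply: (measurableT_comp mZ); exact: measurable_snd.
  exact: (measurable_fun_fubini_tonelli_F (m2 := P) _ mp).
- by move=> u; apply: integral_ge0 => w _; rewrite mule_ge0 ?lee_fin ?powR_ge0.
- by move=> u; rewrite mule_ge0 ?lee_fin//; exact: integral_ge0.
move=> u u0; rewrite -ge0_integralZr//.
apply: eq_integral => w _; rewrite /g -muleA.
(* On [Z_0 = 0] both sides vanish, since [0^alpha = 0]. Elsewhere the rescaled path has norm [u] at
   time 0, so exceedance means [u > 1]. *)
have := f0 (Z w); rewrite le_eqVlt => /predU1P[<-|n0].
  by rewrite powR0 ?gt_eqF// !mul0e.
congr (_ * _); rewrite -EFinM !indicE -natrM mulnb; congr ((nat_of_bool _)%:R%:E).
have E : N (u / f (Z w) *: Z w 0%R) = u.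
  by rewrite (normZ hN) gtr0_norm ?divr_gt0// divfK ?gt_eqF.
rewrite in_setI; congr (_ && _).
by apply/idP/idP; rewrite !inE /exceedance/= in_itv/= andbT E.
Qed.

End tail_process_law.
(** * Existence of a spectral process *)

Section spectral_construction.
Local Open Scope ereal_scope.
Context {R : realType} {d : nat} {N : 'rV[R]_d -> R} (hN : is_norm N).
Context {alpha : R} (halpha : (0 < alpha)%R).
Local Notation D := (cadlag R d).
Context {nu : {measure set D -> \bar R}}.
Hypotheses (tnu : tail_measure N alpha nu) (snu : shift_invariant nu).

Let hnu : homogeneous_measure alpha nu. Proof. by case: tnu. Qed.

Lemma homogeneous_gt (f : D -> R) (r : R) : (0 < r)%R -> measurable_fun setT f ->
  (forall t y, (0 < t)%R -> f (cadlag_scale t y) = (t * f y)%R) ->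
  nu [set y | (r < f y)%R] = (r `^ (- alpha))%:E * nu [set y | (1 < f y)%R].
Proof.
move=> r0 mf fZ; rewrite -hnu//; last exact: measurable_preimage_gt.
congr (nu _); rewrite image_scaleE//; apply/seteqP; split => y /=;
  by rewrite fZ ?invr_gt0// -ltr_pdivrMl ?invr_gt0// invrK mulr1.
Qed.

Lemma tail_measure_eval_gt1 s : nu [set y : D | (1 < N (y s))%R] = 1.
Proof.
case: tnu => _ _ <- _; rewrite -(snu s); last first.
  by apply: measurable_preimage_gt; exact: (measurable_eval hN).
by congr (nu _); apply/seteqP; split => y; rewrite /exceedance /= subrr.
Qed.

(** The default index 0 is taken without a witness only at the null path. *)
Definition first_nonzero (y : D) : nat :=
  if pselect (exists i, (0 < N (y (ratq i)))%R) is left H then ex_minn H else 0%N.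

Let idx := first_nonzero.

Let F i : set D := [set y | (0 < N (y (ratq i)))%R].

(** Off the null path, the sets [seqDU F i] are the level sets of [idx]. *)
Let idxP (y : D) i : seqDU F i y -> idx y = i.
Proof.
rewrite /seqDU -bigcup_mkord => -[Fi Fj]; rewrite /idx /first_nonzero.
case: pselect => [H|[]]; last by exists i.
case: ex_minnP => j yj jmin; apply/eqP; rewrite eqn_leq jmin//= leqNgt.
by apply/negP => ji; apply: Fj; exists j.
Qed.

Let idx_neq0 (y : D) : y <> cadlag0 -> seqDU F (idx y) y.
Proof.
move=> /(cadlag_neq0 hN) H; rewrite /seqDU -bigcup_mkord /idx /first_nonzero.
case: pselect => // H'; case: ex_minnP => j yj jmin; split => //.
by move=> -[k /= kj]; rewrite /F/= => /jmin; rewrite leqNgt kj.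
Qed.

Let idx_scale t (y : D) : (0 < t)%R -> idx (cadlag_scale t y) = idx y.
Proof.
move=> t0; have [->|y0] := pselect (y = cadlag0).
  by congr idx; apply: cadlag_eq => s /=; rewrite scaler0.
apply: idxP; have := idx_neq0 y0; rewrite /seqDU -!bigcup_mkord => -[Fi Fj].
split; first by rewrite /F /= -/(cadlag_scale t y _) norm_eval_scale// mulr_gt0.
move=> [k ki]; rewrite /F /= -/(cadlag_scale t y _) norm_eval_scale// pmulr_rgt0// => Fk.
by apply: Fj; exists k.
Qed.

(** This is [2^(-i)], in the shape of the halving geometric series; [weight 0 = 1] and the total is
    2. *)
Let weight i : R := (2 / (2 ^ (i + 1))%:R)%R.

Let weight_gt0 i : (0 < weight i)%R.
Proof. by rewrite divr_gt0// ltr0n expn_gt0. Qed.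

(** The root is taken because, by homogeneity, multiplying a function by [c i] multiplies the mass
    of its exceedances of 1 by [c i^alpha]. *)
Let c i : R := (weight i `^ alpha^-1)%R.

Let c_gt0 i : (0 < c i)%R. Proof. exact: powR_gt0. Qed.

Let tau0 (y : D) : R := (c (idx y) * N (y (ratq (idx y))))%R.

Let tau0_ge0 y : (0 <= tau0 y)%R.
Proof. by rewrite mulr_ge0 ?norm_ge0// ltW. Qed.

Let tau0_scale t y : (0 < t)%R -> tau0 (cadlag_scale t y) = (t * tau0 y)%R.
Proof. by move=> t0; rewrite /tau0 idx_scale// norm_eval_scale// mulrCA. Qed.

Let tau0_gt0 y : y <> cadlag0 -> (0 < tau0 y)%R.
Proof. by move=> /idx_neq0[]; rewrite /F /= => H _; rewrite mulr_gt0. Qed.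

(** On [seqDU F i] the index is [i]; the null path lies in none of these sets, and [tau0 = 0 <= r]
    there. *)
Let tau0_gtE (r : R) : (0 <= r)%R -> [set y | (r < tau0 y)%R] =
  \bigcup_i (seqDU F i `&` [set y | (r < c i * N (y (ratq i)))%R]).
Proof.
move=> r0; apply/seteqP; split => y /=.
  move=> ry; exists (idx y) => //; split => //; apply: idx_neq0 => y0.
  by move: ry; rewrite /tau0 y0 /= norm0// mulr0 ltNge r0.
by move=> [i _ [/idxP yi]] /=; rewrite /tau0 yi.
Qed.

Let mc i : measurable_fun [set: D] (fun y => c i * N (y (ratq i)))%R.
Proof. by apply: measurable_funM => //; exact: (measurable_eval hN). Qed.

Let mF i : measurable (F i).
Proof. by apply: measurable_preimage_gt; exact: (measurable_eval hN). Qed.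

Let measurable_tau0 : measurable_fun setT tau0.
Proof.
move=> mD; apply: (measurability _ (RGenOInfty.measurableE R)) => //.
move=> _ [_ [r ->] <-]; rewrite setTI.
rewrite (_ : _ @^-1` _ = [set y | (r < tau0 y)%R]); last first.
  by apply/seteqP; split => y; rewrite /= in_itv/= andbT.
have [r0|r0] := leP 0%R r; last first.
  rewrite (_ : [set y | _] = setT)//; apply/seteqP; split => // y _ /=.
  exact: lt_le_trans (tau0_ge0 y).
rewrite tau0_gtE//; apply: bigcupT_measurable => i; apply: measurableI.
  by apply: measurableD => //; exact: bigsetU_measurable.
exact: measurable_preimage_gt (mc i).
Qed.

Let c_mass i : nu [set y : D | (1 < c i * N (y (ratq i)))%R] = (weight i)%:E.
Proof.
have ci0 : (0 < (c i)^-1)%R by rewrite invr_gt0.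
rewrite (_ : [set y | _] = [set y : D | ((c i)^-1 < N (y (ratq i)))%R]); last first.
  by apply/seteqP; split => y; rewrite /= -ltr_pdivrMl ?mulr1.
rewrite (homogeneous_gt ci0 (measurable_eval hN _)); last by move=> t y; exact: norm_eval_scale.
rewrite tail_measure_eval_gt1 mule1 -powR_inv1 ?ltW// -powRrM mulN1r opprK.
by rewrite /c -powRrM mulVf ?gt_eqF// powRr1// ltW.
Qed.

(** The mass is at least 1 since [c 0 = 1] and index 0 comes first; it is finite by a union bound,
    the weights being summable. *)
Let tau0_mass : 1 <= nu [set y | (1 < tau0 y)%R] < +oo.
Proof.
apply/andP; split.
  rewrite -[leLHS](tail_measure_eval_gt1 (ratq 0)); apply: le_measure; rewrite ?inE.
  - exact: measurable_preimage_gt (measurable_eval hN _).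
  - exact: measurable_preimage_gt.
  - move=> y /= y1; have y0 : seqDU F 0 y.
      by rewrite /seqDU big_ord0 setD0 /F /= (lt_trans ltr01).
    by rewrite /tau0 (idxP y0) /c /weight add0n expn1 divff// powR1 mul1r.
apply: (@le_lt_trans _ _ (\sum_(i <oo) nu [set y : D | (1 < c i * N (y (ratq i)))%R])).
  apply: measure_sigma_subadditive.
  - by move=> i; exact: measurable_preimage_gt (mc i).
  - exact: measurable_preimage_gt.
  - by rewrite tau0_gtE//; apply: subset_bigcup => i _ y [].
under eq_eseriesr do rewrite c_mass.
have /cvg_lim -> // := @cvg_geometric_eseries_half R 2%R 0%N.
exact: ltry.
Qed.

(* [tau y] is a multiple of [c i * N (y (ratq i))], with [ratq i] the first
   rational in the enumeration where [y] does not vanish; the weights [c i] keep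
   the mass of [1 < tau y] finite. *)
Lemma ex_polar_norm : exists tau : D -> R,
  [/\ measurable_fun setT tau,
      forall t y, (0 < t)%R -> tau (cadlag_scale t y) = (t * tau y)%R,
      forall y, y <> cadlag0 -> (0 < tau y)%R &
      nu [set y | (1 < tau y)%R] = 1].
Proof.
have /andP[s1 soo] := tau0_mass.
have [s sE] : exists s : R, nu [set y | (1 < tau0 y)%R] = s%:E.
  by exists (fine (nu [set y | (1 < tau0 y)%R])); rewrite fineK// ge0_fin_numE.
have s0 : (0 < s)%R by rewrite -lte_fin -sE (lt_le_trans lte01).
(* Dividing [tau0] by [k] divides the mass [s] by [k^alpha = s]. *)
pose k : R := (s `^ alpha^-1)%R.
have k0 : (0 < k)%R by rewrite powR_gt0.
exists (fun y => k^-1 * tau0 y)%R; split.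
- exact: measurable_funM.
- by move=> t y t0; rewrite tau0_scale// mulrCA.
- by move=> y y0; rewrite mulr_gt0 ?invr_gt0// tau0_gt0.
rewrite (_ : [set y | _] = [set y | (k < tau0 y)%R]); last first.
  by apply/seteqP; split => y; rewrite /= ltr_pdivlMl ?mulr1.
rewrite homogeneous_gt// sE -EFinM -powRrM mulrN mulVf ?gt_eqF//.
by rewrite powR_inv1 ?ltW// mulVf ?gt_eqF.
Qed.

End spectral_construction.

(** * From a shift-invariant tail measure to a spectral process *)

Section spectral_existence.
Local Open Scope ereal_scope.
Context {R : realType} {d : nat} {N : 'rV[R]_d -> R} (hN : is_norm N).
Context {alpha : R} (halpha : (0 < alpha)%R).
Local Notation D := (cadlag R d).
Context {nu : {measure set D -> \bar R}}.
Hypotheses (tnu : tail_measure N alpha nu) (snu : shift_invariant nu).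

Let hnu : homogeneous_measure alpha nu. Proof. by case: tnu. Qed.

Let nu0 : nu [set cadlag0] = 0. Proof. by case: tnu. Qed.

(** Each condition on [Z] is a property of [nu] read through [integral_spectral_gt1]: the moments
    are masses of sets [[f > 1]], and the time change formula is shift invariance. *)
Lemma tail_measure_spectral_process {disp} {Om : measurableType disp}
    {P : probability Om R} {Z : {RV P >-> D}} :
  P (Z @^-1` [set cadlag0]) = 0 ->
  (forall A, measurable A -> nu A = spectral_measure halpha P Z A) ->
  spectral_process N alpha nu Z.
Proof.
move=> Z0 nuE; have mZ : measurable_fun setT Z by exact: measurable_funP.
have gt1 := integral_spectral_gt1 mZ nuE.
have gt1_1 (f : D -> R) : measurable_fun setT f -> (forall y, 0 <= f y)%R ->
    (forall t y, (0 < t)%R -> f (cadlag_scale t y) = (t * f y)%R) ->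
    \int[P]_w (f (Z w) `^ alpha)%:E = nu [set y | (1 < f y)%R].
  move=> mf f0 fZ.
  have := gt1 f (cst 1%R) mf f0 fZ (measurable_cst _) (fun _ => ler01) (fun _ _ _ => erefl).
  under eq_integral do rewrite mul1e.
  rewrite integral_indic ?setIT//; last exact: measurable_preimage_gt.
  by move=> ->; apply: eq_integral => w _; rewrite mulr1.
split => //.
- rewrite unlock (gt1_1 (fun y => N (y 0%R))).
  + by case: tnu.
  + exact: (measurable_eval hN).
  + by move=> y; exact: norm_ge0.
  + by move=> t y; exact: norm_eval_scale.
- by move=> A mA; rewrite spectral_formulaE// nuE.
- move=> a b t H ab mH _ HZ; split.
    rewrite (_ : \int[P]_w _ = nu [set y | (1 < cadlag_sup (N := N) a b y)%R]); last first.
      rewrite -gt1_1.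
      + by apply: eq_integral => w _; rewrite (sup_on_powR hN)// ltW.
      + by apply: (measurable_cadlag_sup hN); exact: ltW.
      + by move=> y; apply: (cadlag_sup_ge0 hN); exact: ltW.
      + by move=> s y s0; apply: (cadlag_sup_scale hN) => //; exact: ltW.
    have mS : measurable [set y | (1 < cadlag_sup (N := N) a b y)%R].
      by apply: measurable_preimage_gt; apply: (measurable_cadlag_sup hN); exact: ltW.
    apply/andP; split.
      (* The supremum dominates the value at [a], which exceeds 1 on a set of mass 1. *)
      rewrite (@lt_le_trans _ _ 1)// -(tail_measure_eval_gt1 hN tnu snu a).
      apply: le_measure; rewrite ?inE//.
        by apply: measurable_preimage_gt; exact: (measurable_eval hN).
      move=> y /= /lt_le_trans; apply; apply: (cadlag_sup_ge hN).
      by rewrite lexx ltW.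
    case: tnu => -[_ fin] _ _ _; apply: fin => //.
    by apply: (cadlag_sup_separated hN) => //; exact: ltW.
  (* Nonnegative case: both sides are integrals against [nu], exchanged by the shift. *)
  have main (G : D -> R) : measurable_fun setT G -> (forall y, 0 <= G y)%R ->
      (forall s y, (0 < s)%R -> G (cadlag_scale s y) = G y) ->
      \int[P]_w (N (Z w t) `^ alpha * G (Z w))%:E =
      \int[P]_w (N (Z w 0%R) `^ alpha * G (cadlag_shift t (Z w)))%:E.
    move=> mG G0 GZ.
    have mt := @measurable_shift R d t.
    have mGt : measurable_fun setT (fun y => G (cadlag_shift t y)).
      exact: measurableT_comp.
    have nZ r s y : (0 < s)%R -> N (cadlag_scale s y r) = (s * N (y r))%R.
      exact: norm_eval_scale.
    pose phi (y : D) : \bar R := (G y)%:E * (\1_[set y : D | (1 < N (y t))%R] y)%:E.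
    have mphi : measurable_fun setT phi.
      apply: emeasurable_funM; apply/measurable_EFinP => //.
      by apply: measurable_indic; apply: measurable_preimage_gt; exact: (measurable_eval hN).
    rewrite -(gt1 (fun y => N (y t)) G (measurable_eval hN t) _ (nZ t) mG G0 GZ); last first.
      by move=> y; exact: norm_ge0.
    rewrite -(gt1 (fun y => N (y 0%R)) (fun y => G (cadlag_shift t y))
      (measurable_eval hN 0%R) _ (nZ 0%R) mGt)//; last 2 first.
      by move=> y; exact: norm_ge0.
      by move=> s y s0; rewrite cadlag_shift_scale GZ.
    transitivity (\int[pushforward nu (cadlag_shift t)]_y phi y).
      by apply: eq_measure_integral => A mA _; exact/esym/snu.
    rewrite ge0_integral_pushforward//; last by move=> y _; rewrite mule_ge0 ?lee_fin.
    apply: eq_integral => y _; rewrite /phi /= !indicE; congr (_ * (nat_of_bool _)%:R%:E).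
    by apply/idP/idP; rewrite !inE /= subrr.
  have HZ1 s y : (0 < s)%R -> H (cadlag_scale s y) = H y.
    by move=> s0; rewrite HZ// powRr0 mul1r.
  (* A signed [H] is split into positive and negative parts, which the nonnegative factor leaves
     0-homogeneous. *)
  have posE s (G : D -> R) w : maxe (N (Z w s) `^ alpha * G (Z w))%:E 0 =
      (N (Z w s) `^ alpha * Num.max (G (Z w)) 0)%:E.
    by rewrite -EFin_max maxr_pMr ?powR_ge0// mulr0.
  have mpos (G : D -> R) : measurable_fun setT G ->
      measurable_fun setT (fun y => Num.max (G y) 0%R).
    by move=> mG; exact: measurable_maxr.
  have ge0_pos (G : D -> R) y : (0 <= Num.max (G y) 0)%R by rewrite le_max lexx orbT.
  rewrite unlock integralE [RHS]integralE; congr (_ - _).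
    under eq_integral do rewrite funeposE (posE t H).
    rewrite (main (fun y => Num.max (H y) 0)%R)//; last 2 first.
    - exact: (mpos H mH).
    - by move=> s y s0; rewrite HZ1.
    apply: eq_integral => w _.
    by rewrite funeposE (posE 0%R (fun y => H (cadlag_shift t y))).
  under eq_integral do rewrite funenegE -EFinN -mulrN (posE t (fun y => - H y)%R).
  rewrite (main (fun y => Num.max (- H y) 0)%R)//; last 3 first.
  - by apply: (mpos (fun y => - H y)%R); exact: measurableT_comp.
  - by move=> y; exact: (ge0_pos (fun y => - H y)%R).
  - by move=> s y s0; rewrite HZ1.
  apply: eq_integral => w _; rewrite funenegE -EFinN -mulrN.
  by rewrite (posE 0%R (fun y => - H (cadlag_shift t y))%R).
Qed.

(** * Polar decomposition under [nu] restricted to [[tau > 1]] *)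

Section polar_law.
Variable tau : D -> R.
Hypotheses (mtau : measurable_fun setT tau)
  (tauZ : forall t y, (0 < t)%R -> tau (cadlag_scale t y) = (t * tau y)%R)
  (tau_gt0 : forall y, y <> cadlag0 -> (0 < tau y)%R)
  (tau1 : nu [set y | (1 < tau y)%R] = 1).

Let tau0 : tau cadlag0 = 0%R.
Proof.
have := @tauZ 2%R cadlag0 (ltr0n _ 2).
have -> : cadlag_scale 2 cadlag0 = cadlag0 :> D.
  by apply: cadlag_eq => s /=; rewrite scaler0.
by lra.
Qed.

Let tau_ge0 y : (0 <= tau y)%R.
Proof.
have [->|/tau_gt0/ltW//] := pselect (y = cadlag0); first by rewrite tau0.
Qed.

Let mtau1 : measurable [set y | (1 < tau y)%R].
Proof. exact: measurable_preimage_gt. Qed.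

(* The normalization is a parameter only so that it is found by inference. *)
Definition polar_law of nu [set y | (1 < tau y)%R] = 1 : set D -> \bar R :=
  mrestr nu mtau1.

Local Notation Q := (polar_law tau1).

HB.instance Definition _ := Measure.on Q.

Let polar_lawT : Q setT = 1.
Proof. by rewrite /polar_law /mrestr setTI. Qed.

HB.instance Definition _ := Measure_isProbability.Build _ _ _ Q polar_lawT.

Definition polar_angle (y : D) : D := cadlag_scale (tau y)^-1 y.

Lemma measurable_polar_angle : measurable_fun setT polar_angle.
Proof. by apply: measurable_scale_comp => //; exact: measurable_funV_ge0. Qed.

Let polar_angle_scale t y : (0 < t)%R -> polar_angle (cadlag_scale t y) = polar_angle y.
Proof.
move=> t0; rewrite /polar_angle tauZ// cadlag_scaleA.
by rewrite invfM mulrAC mulVf ?gt_eqF// mul1r.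
Qed.

Let mpre (S : set D) : measurable S -> measurable (polar_angle @^-1` S).
Proof. by move=> mS; rewrite -[X in measurable X]setTI; exact: measurable_polar_angle. Qed.

(** The dilation by [r] maps [[tau > 1]] with angle in [S] onto [[tau > r]] with angle in [S]. So
    [tau] is Pareto and independent of the angle. *)
Let polar_law_gt (r : R) (S : set D) : (1 <= r)%R -> measurable S ->
  Q [set y | (r < tau y)%R /\ S (polar_angle y)] =
  (r `^ (- alpha))%:E * Q (polar_angle @^-1` S).
Proof.
move=> r1 mS; have r0 := lt_le_trans ltr01 r1.
rewrite /polar_law /mrestr -hnu//; last by apply: measurableI => //; exact: mpre.
congr (nu _); rewrite image_scaleE//; apply/seteqP; split => y /=.
  move=> [[ry Sy] y1]; split; first by rewrite polar_angle_scale ?invr_gt0.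
  by rewrite tauZ ?invr_gt0// ltr_pdivlMl// mulr1.
rewrite polar_angle_scale ?invr_gt0// tauZ ?invr_gt0// ltr_pdivlMl// mulr1 => -[Sy ry].
by split => //; exact: le_lt_trans ry.
Qed.

Let tau_angle y : (0 < tau y)%R -> tau (polar_angle y) = 1%R.
Proof. by move=> y0; rewrite tauZ ?invr_gt0// mulVf ?gt_eqF. Qed.

(** On [[tau > 1]] the angle has [tau = 1], whereas the null path has [tau = 0]. *)
Lemma polar_angle_neq0 : Q (polar_angle @^-1` [set cadlag0]) = 0.
Proof.
rewrite /polar_law /mrestr (_ : _ `&` _ = set0) ?measure0//.
apply/seteqP; split => y //= [y0 y1].
by have := @tau_angle y; rewrite y0 tau0 => /(_ (lt_trans ltr01 y1)); lra.
Qed.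

(** Both measures are homogeneous and ignore the null path, so subsets of [[tau > 1]] suffice; there
    [y] is [tau y] times its angle, and the joint law applies. *)
Lemma polar_lawE A : measurable A ->
  nu A = spectral_measure halpha Q polar_angle A.
Proof.
have [m mE] := spectral_measure_is_measure halpha Q measurable_polar_angle.
have m0 : m [set cadlag0] = 0.
  rewrite mE; last exact: (measurable_cadlag0 hN).
  exact: (spectral_measure0 hN halpha measurable_polar_angle polar_angle_neq0).
have hm : homogeneous_measure alpha m.
  move=> t B t0 mB; have mtB := measurable_image_scale t0 mB.
  transitivity (spectral_measure halpha Q polar_angle (cadlag_scale t @` B)).
    by rewrite -mE.
  transitivity ((t `^ (- alpha))%:E * spectral_measure halpha Q polar_angle B); last by rewrite -mE.
  exact: (spectral_measure_homogeneous halpha Q measurable_polar_angle t0 mB).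
have key B : measurable B -> B `<=` [set y | (1 < tau y)%R] -> nu B = m B.
  move=> mB B1; rewrite mE//.
  have mB1 : measurable_fun setT (fun y : D => (\1_B y : R)%:E).
    by apply/measurable_EFinP; exact: measurable_indic.
  have mBs : measurable_fun [set: measurableTypeR R * D]
      (fun p => (\1_B (cadlag_scale p.1 p.2) : R)%:E).
    exact: (measurableT_comp mB1 measurable_scale2).
  have Bs0 (p : measurableTypeR R * D) : 0 <= (\1_B (cadlag_scale p.1 p.2) : R)%:E.
    by rewrite lee_fin.
  have joint := pareto_joint_law halpha (P := Q) mtau measurable_polar_angle
    polar_law_gt mBs Bs0.
  have mBu u : measurable [set y | B (cadlag_scale u (polar_angle y))].
    rewrite -[X in measurable X]setTI.
    exact: (measurable_scale_comp (measurable_cst u) measurable_polar_angle).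
  have indQ u : \int[Q]_y (\1_B (cadlag_scale u (polar_angle y)))%:E =
      Q [set y | B (cadlag_scale u (polar_angle y))].
    transitivity (\int[Q]_y (\1_[set y | B (cadlag_scale u (polar_angle y))] y)%:E) => //.
    by rewrite integral_indic ?setIT.
  transitivity (\int[Q]_y (\1_B (cadlag_scale (tau y) (polar_angle y)))%:E).
    have angleK y : cadlag_scale (tau y) (polar_angle y) = y.
      rewrite /polar_angle cadlag_scaleA.
      have [->|/tau_gt0 y0] := pselect (y = cadlag0).
        by apply: cadlag_eq => s /=; rewrite scaler0.
      by rewrite divff ?gt_eqF// cadlag_scale1.
    under eq_integral do rewrite angleK.
    rewrite integral_indic// setIT.
    by transitivity (nu (B `&` [set y | (1 < tau y)%R])) => //; rewrite setIidl.
  rewrite [LHS]joint; apply: ge0_eq_integral_pareto.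
  - apply: emeasurable_funM; last by apply/measurable_EFinP; exact: measurable_indic.
    under eq_fun do rewrite indQ.
    exact: (measurable_scale_law Q measurable_polar_angle mB).
  - exact: (measurable_scale_law Q measurable_polar_angle mB).
  - by move=> u; rewrite mule_ge0 ?lee_fin//; exact: integral_ge0.
  - by move=> u.
  (* For [u <= 1] the indicator kills one side; the other vanishes because [u] times an angle has
     [tau = u], while [B] lies in [[tau > 1]]. *)
  move=> u u0; rewrite /= indQ indicE mem_setE in_itv/= andbT.
  have [u1|u1] := ltP 1%R u; first by rewrite mule1.
  rewrite mule0; transitivity (nu set0); first by rewrite measure0.
  congr (nu _); apply/esym; rewrite -subset0 => y [/= /B1 /=].
  rewrite tauZ// => + y1; rewrite tau_angle ?(lt_trans ltr01 y1)// mulr1.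
  by rewrite ltNge u1.
move=> mA; rewrite -mE//.
apply: (@eq_measure_bigcup _ _ _ nu m
  (fun i => if i is 0%N then [set cadlag0] else [set y | (0 < tau y)%R])) => //.
- move=> [|i]; first exact: (measurable_cadlag0 hN).
  exact: measurable_preimage_gt.
- move=> [|i] B mB B0.
    by rewrite !(subset_measure0 mB (measurable_cadlag0 hN) B0).
  exact: (eq_homogeneous_measure hnu hm mtau tauZ key).
- move=> y _; have [->|/tau_gt0 y0] := pselect (y = cadlag0).
    by exists 0%N.
  by exists 1%N.
Qed.

End polar_law.

(** The probability space is the path space itself, under [nu] restricted to [[tau > 1]], and [Z] is
    the angle. *)
Lemma exists_spectral_process :
  exists (disp : measure_display) (Om : measurableType disp)
    (P : probability Om R) (Z : {RV P >-> D}), spectral_process N alpha nu Z.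
Proof.
have [tau [mtau tauZ tau_gt0 tau1]] := ex_polar_norm hN halpha tnu snu.
have mZ := measurable_polar_angle mtau tauZ tau_gt0.
exists _, D, (polar_law mtau tau1 : probability D R), (mfun_Sub (mem_set mZ)).
apply: tail_measure_spectral_process.
  exact: polar_angle_neq0.
exact: polar_lawE.
Qed.

End spectral_existence.

(** * Characterization, determination by the tail process, and law of the tail process *)

Unset Implicit Arguments.

Theorem theorem2p3 (R : realType) (d : nat) (hd : (0 < d)%N)
    (N : 'rV[R]_d -> R) (hN : is_norm N) (alpha : R) (halpha : 0 < alpha) :
  (forall nu : {measure set (cadlag R d) -> \bar R},
     (tail_measure N alpha nu /\ shift_invariant nu) <->
     (exists (disp : measure_display) (Om : measurableType disp)
             (P : probability Om R) (Z : {RV P >-> cadlag R d}),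
        spectral_process N alpha nu Z)) /\
  (forall (nu nu' : {measure set (cadlag R d) -> \bar R}) (alpha' : R)
          (disp : measure_display) (Om : measurableType disp)
          (P : probability Om R) (Y : {RV P >-> cadlag R d})
          (disp' : measure_display) (Om' : measurableType disp')
          (P' : probability Om' R) (Y' : {RV P' >-> cadlag R d}),
     0 < alpha' ->
     tail_measure N alpha nu -> shift_invariant nu -> tail_process N nu Y ->
     tail_measure N alpha' nu' -> shift_invariant nu' -> tail_process N nu' Y' ->
     (forall A, measurable A -> distribution P Y A = distribution P' Y' A) ->
     forall A, measurable A -> nu A = nu' A) /\
  (forall (nu : {measure set (cadlag R d) -> \bar R})
          (disp : measure_display) (Om : measurableType disp)
          (P : probability Om R) (Z : {RV P >-> cadlag R d})
          (W : {RV P >-> R})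
          (disp' : measure_display) (Om' : measurableType disp')
          (P' : probability Om' R) (Y : {RV P' >-> cadlag R d}),
     tail_measure N alpha nu -> shift_invariant nu ->
     spectral_process N alpha nu Z ->
     pareto alpha W -> independent_rv W Z ->
     tail_process N nu Y ->
     forall A, measurable A ->
       distribution P' Y A =
       weighted_law P (fun w => N (Z w 0) `^ alpha)
         (fun w => cadlag_scale (W w / N (Z w 0)) (Z w)) A).
Proof.
split; [|split].
- move=> nu; split=> [[tnu snu]|[disp [Om [P [Z spZ]]]]].
    exact: (exists_spectral_process hN halpha tnu snu).
  split; first exact: (spectral_tail_measure hN halpha spZ).
  exact: (spectral_shift_invariant hN halpha spZ).
- move=> nu nu' alpha' disp Om P Y disp' Om' P' Y' _ tnu snu Ynu tnu' snu' Ynu' YY'.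
  apply: (tail_measure_unique hN tnu snu tnu' snu') => A mA.
  by rewrite -Ynu// -Ynu'// YY'.
- move=> nu disp Om P Z W disp' Om' P' Y _ _ spZ paretoW indep Ynu A mA.
  by rewrite Ynu// (tail_process_law hN halpha spZ paretoW indep mA).
Qed.
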